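(* Let $\mathcal{A}$ and $\mathcal{B}$ be uniform algebras on compact Hausdorff spaces $X$ and $Y$ respectively. Suppose that $T$ is a map from $\mathcal{A}^{-1}$ onto $\mathcal{B}^{-1}$ such that the equality $$\|Tf\,Tg-1\|_{\infty(Y)}=\|fg-1\|_{\infty(X)}$$ holds for every $f,g\in\mathcal{A}^{-1}$. Then $(T1)^2=1$ and the map $T$ is extended to a map $T_E$ from $\mathcal{A}$ onto $\mathcal{B}$, and there exist a homeomorphism $\phi$ from $\mathrm{Ch}(\mathcal{B})$ onto $\mathrm{Ch}(\mathcal{A})$ and a clopen subset $K$ of $\mathrm{Ch}(\mathcal{B})$ such that the equality $$T_Ef(y)=T1(y)\times\begin{cases} f(\phi(y)), & y\in K,\\ \overline{f(\phi(y))}, & y\in\mathrm{Ch}(\mathcal{B})\setminus K\end{cases}$$ holds for every $f\in\mathcal{A}$. In particular, $\frac{T_E}{T1}$ (the map $f\mapsto T_Ef/T1$) is a real-algebra isomorphism. Thus the equality $$\|T_Ef\,T_Eg-1\|_{\infty(Y)}=\|fg-1\|_{\infty(X)}$$ holds for every pair $f$ and $g$ in $\mathcal{A}$.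
   Context: A uniform algebra on a compact Hausdorff space $X$ is a uniformly closed subalgebra of $C(X)$ (complex-valued continuous functions) which contains the constants and separates the points of $X$. $A^{-1}$ denotes the group of invertible elements of $A$. $\|g\|_{\infty(K)}$ is the supremum norm of $g$ on $K$. $\mathrm{Ch}(\mathcal{A})\subset X$ is the Choquet boundary of $\mathcal{A}$, with the relative topology. The map $T$ is not assumed to be linear or multiplicative. A real-algebra isomorphism is a bijective real-linear multiplicative map. *)

(* Defs.v *)
From HB Require Import structures.
From mathcomp Require Import all_boot all_order all_algebra.
From mathcomp Require Import complex.
From mathcomp Require Import all_classical all_reals all_analysis.

Set Implicit Arguments.
Unset Strict Implicit.
Unset Printing Implicit Defensive.

Import Order.TTheory GRing.Theory Num.Theory.
Import numFieldNormedType.Exports.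

Local Open Scope classical_set_scope.
Local Open Scope complex_scope.
Local Open Scope ring_scope.

(* The complex numbers R[i], folded behind a name so that the norm topology that
   MathComp-Analysis puts on an arbitrary numClosedFieldType applies to them. *)
Definition cplx (R : realType) : numClosedFieldType := R[i].

Definition of_real (R : realType) (r : R) : cplx R := r%:C.

(* The norm of [cplx R] takes values in [cplx R], and its values are real, so that
   nothing is lost by [complex.Re].  The supremum over an empty space is 0. *)
Definition supnorm (R : realType) (X : Type) (f : X -> cplx R) : R :=
  sup [set complex.Re `|f x| | x in [set: X]].

(* The subalgebra [A] of C(X) is represented by a set of functions.  Since a uniform
   limit of continuous functions is continuous, being closed in C(X) for the
   supremum norm is being closed in [{uniform X -> cplx R}]. *)
Record uniform_algebra (R : realType) (X : topologicalType)
    (A : set (X -> cplx R)) : Prop := UniformAlgebra {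
  ua_continuous : forall f, A f -> continuous f ;
  ua_cst : forall c : cplx R, A (cst c) ;
  ua_add : forall f g, A f -> A g -> A (f + g) ;
  ua_scale : forall (c : cplx R) f, A f -> A (c *: f) ;
  ua_mul : forall f g, A f -> A g -> A (f * g) ;
  ua_separates : forall x y, x <> y -> exists2 f, A f & f x <> f y ;
  ua_closed : closed (A : set {uniform X -> cplx R}) }.

(* The inverse has to be in [A] too. *)
Definition ua_inv (R : realType) (X : Type) (A : set (X -> cplx R)) :
    set (X -> cplx R) :=
  [set f | A f /\ exists2 g, A g & f * g = 1].

(* States of [A]: linear functionals [L] on [A] with L(1) = 1 and norm at most 1.
   The values of [L] outside of [A] are irrelevant. *)
Record is_state (R : realType) (X : Type) (A : set (X -> cplx R))
    (L : (X -> cplx R) -> cplx R) : Prop := IsState {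
  state_linear : forall (c : cplx R) f g, A f -> A g ->
    L (c *: f + g) = c * L f + L g ;
  state_one : L 1 = 1 ;
  state_norm : forall f, A f -> complex.Re `|L f| <= supnorm f }.

(* The points of [X] whose evaluation functional is an extreme point of the
   state space of [A]. *)
Definition choquet (R : realType) (X : Type) (A : set (X -> cplx R)) : set X :=
  [set x | forall (t : R) (L1 L2 : (X -> cplx R) -> cplx R),
     0 < t < 1 -> is_state A L1 -> is_state A L2 ->
     (forall f, A f -> f x = of_real t * L1 f + of_real (1 - t) * L2 f) ->
     forall f, A f -> L1 f = f x /\ L2 f = f x].

Definition homeomorphism (S T : topologicalType) (phi : S -> T) : Prop :=
  continuous phi /\
  exists psi : T -> S, [/\ cancel phi psi, cancel psi phi & continuous psi].

Record real_algebra_iso (R : realType) (X Y : Type)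
    (A : set (X -> cplx R)) (B : set (Y -> cplx R))
    (S : (X -> cplx R) -> (Y -> cplx R)) : Prop := RealAlgebraIso {
  rai_bij : set_bij A B S ;
  rai_linear : forall (r : R) f g, A f -> A g ->
    S (of_real r *: f + g) = of_real r *: S f + S g ;
  rai_mul : forall f g, A f -> A g -> S (f * g) = S f * S g }.

(* Main.v *)
(* Dividing by [T 1], whose square is 1, one may assume that the map [S] sends
   1 to 1; it is then a bijection with [S (1/f) = 1 / S f].  Let y be a point of
   the Choquet boundary of [B].  Take preimages under [S] of invertible functions
   of large norm concentrated near y: their maximum points accumulate at a point x
   with |S f (y)| = |f(x)| for all f.  Applying the norm equality to functions
   peaking at y and scaled so that [S l] times the function is close to -M at y,
   and letting M go to infinity, gives Re (k(x)/l(x)) <= Re (Sk(y)/Sl(y)).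
   By surjectivity this is an equality, so that [S] acts at y as k |-> k(x) or as
   k |-> conj (k(x)), and S i (y) = i or -i decides between the two.

   The peaking functions are 1 / (1 - h), with Re h <= 0, Re h very negative away
   from the point and nearly 0 at it.  That such an h exists at a point of the
   Choquet boundary, defined by extreme states, follows from the Hahn-Banach
   theorem: otherwise the evaluation would be a proper convex combination of
   states, one of them supported away from the point. *)
Require Import Defs.
From HB Require Import structures.
From mathcomp Require Import all_boot all_order all_algebra.
From mathcomp Require Import complex.
From mathcomp Require Import ring lra.
From mathcomp Require Import all_classical all_reals all_analysis.

Set Implicit Arguments.
Unset Strict Implicit.
Unset Printing Implicit Defensive.

Import Order.TTheory GRing.Theory Num.Theory.
Import numFieldNormedType.Exports.

Local Open Scope classical_set_scope.
Local Open Scope ring_scope.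

(** * Real and imaginary parts, modulus *)

(** The disc of the peaking functions is essential. If their values merely filled the unit disc, |M
    a w + 1| would only be bounded by M |a| + 1, which says nothing about Re a. On the disc of
    diameter [0, 1] the bound is |1 + M a / 2| + M |a| / 2, which for large M is close to M |a| + Re
    a / |a|; compared with |M b + 1| for |b| = |a|, it isolates the real parts.

    The other obstacle is that the norm on [X] is attained at some x' that need not be x, at a stage
    where [S] is only known to respect moduli. That q = k / l is near its value b = q(x) at x' is
    read off the moduli of q - b + C and q - b - C: both are at most about C only where q is near b.

    Measures are avoided: that a functional lives on a closed set is expressed by an inequality
    ([supported]), and Hahn-Banach enters as a sandwich theorem. *)

Definition re (R : realType) (z : cplx R) : R := complex.Re z.
Definition im (R : realType) (z : cplx R) : R := complex.Im z.
Definition nrm (R : realType) (z : cplx R) : R := complex.Re `|z|.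
Definition ii (R : realType) : cplx R := Complex 0 1.

Section Complex.
Variable R : realType.
Implicit Types (z w : cplx R) (r : R).

Lemma cplx_eq z w : re z = re w -> im z = im w -> z = w.
Proof. by case: z => a b; case: w => c d; rewrite /re /im /= => -> ->. Qed.

Lemma reD z w : re (z + w) = re z + re w.
Proof. by case: z; case: w. Qed.

Lemma imD z w : im (z + w) = im z + im w.
Proof. by case: z; case: w. Qed.

Lemma reN z : re (- z) = - re z. Proof. by case: z. Qed.
Lemma imN z : im (- z) = - im z. Proof. by case: z. Qed.

Lemma reB z w : re (z - w) = re z - re w. Proof. by rewrite reD reN. Qed.
Lemma imB z w : im (z - w) = im z - im w. Proof. by rewrite imD imN. Qed.

Lemma reM z w : re (z * w) = re z * re w - im z * im w.
Proof. by case: z; case: w. Qed.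

Lemma imM z w : im (z * w) = re z * im w + im z * re w.
Proof. by case: z => a b; case: w => c d; rewrite /re /im /= [a * d + _]addrC addrC. Qed.

Lemma re0 : re (0 : cplx R) = 0. Proof. by []. Qed.
Lemma im0 : im (0 : cplx R) = 0. Proof. by []. Qed.
Lemma re1 : re (1 : cplx R) = 1. Proof. by []. Qed.
Lemma im1 : im (1 : cplx R) = 0. Proof. by []. Qed.
Lemma re_real r : re (of_real r) = r. Proof. by []. Qed.
Lemma im_real r : im (of_real r) = 0. Proof. by []. Qed.
Lemma re_ii : re (ii R) = 0. Proof. by []. Qed.
Lemma im_ii : im (ii R) = 1. Proof. by []. Qed.
Lemma re_conj z : re (Num.conj z) = re z. Proof. by case: z. Qed.
Lemma im_conj z : im (Num.conj z) = - im z. Proof. by case: z. Qed.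

Definition cE := (reB, imB, reD, imD, reN, imN, reM, imM, re0, im0, re1, im1,
  re_real, im_real, re_ii, im_ii, re_conj, im_conj).

Lemma of_realD r s : of_real (r + s) = of_real r + of_real s :> cplx R.
Proof. by apply: cplx_eq; rewrite !cE ?addr0. Qed.

Lemma of_realM r s : of_real (r * s) = of_real r * of_real s :> cplx R.
Proof. by apply: cplx_eq; rewrite !cE; ring. Qed.

Lemma of_realN r : of_real (- r) = - of_real r :> cplx R.
Proof. by apply: cplx_eq; rewrite !cE ?oppr0. Qed.

Lemma of_real1 : of_real 1 = 1 :> cplx R. Proof. by []. Qed.

Lemma ii_sqr : ii R * ii R = -1.
Proof. by apply: cplx_eq; rewrite !cE; ring. Qed.

Lemma nrmE z : nrm z = Num.sqrt (re z ^+ 2 + im z ^+ 2).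
Proof. by rewrite /nrm normc_def. Qed.

Lemma nrm_norm z : `|z| = of_real (nrm z).
Proof. by rewrite /nrm normc_def. Qed.

Lemma nrm_sqr z : nrm z ^+ 2 = re z ^+ 2 + im z ^+ 2.
Proof. by rewrite nrmE sqr_sqrtr // addr_ge0 // sqr_ge0. Qed.

Lemma nrm_ge0 z : 0 <= nrm z. Proof. by rewrite nrmE sqrtr_ge0. Qed.

Lemma nrmM z w : nrm (z * w) = nrm z * nrm w.
Proof.
have /(congr1 (@re R)) := normrM z w.
by rewrite !nrm_norm -of_realM !re_real.
Qed.

Lemma nrmD z w : nrm (z + w) <= nrm z + nrm w.
Proof.
have := ler_normD z w.
by rewrite !nrm_norm -of_realD /of_real lecR.
Qed.

Lemma nrmN z : nrm (- z) = nrm z. Proof. by rewrite /nrm normrN. Qed.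
Lemma nrm1 : nrm (1 : cplx R) = 1. Proof. by rewrite /nrm normr1. Qed.
Lemma nrm0 : nrm (0 : cplx R) = 0. Proof. by rewrite /nrm normr0. Qed.

Lemma nrmB z w : nrm (z - w) <= nrm z + nrm w.
Proof. by rewrite -(nrmN w) nrmD. Qed.

Lemma nrm_distC z w : nrm (z - w) = nrm (w - z).
Proof. by rewrite -nrmN opprB. Qed.

Lemma lerB_nrm z w : nrm z - nrm w <= nrm (z - w).
Proof. by rewrite lerBlDr; have := nrmD (z - w) w; rewrite subrK. Qed.

Lemma nrmX z n : nrm (z ^+ n) = nrm z ^+ n.
Proof. by elim: n => [|n IH]; rewrite ?expr0 ?nrm1 // !exprS nrmM IH. Qed.

Lemma nrm_real r : nrm (of_real r) = `|r|.
Proof. by rewrite nrmE !cE expr0n addr0 sqrtr_sqr. Qed.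

Lemma nrm_ii : nrm (ii R) = 1.
Proof. by rewrite nrmE !cE expr0n expr1n add0r sqrtr1. Qed.

Lemma nrm_conj z : nrm (Num.conj z) = nrm z.
Proof. by rewrite !nrmE !cE sqrrN. Qed.

Lemma ler_re_nrm z : `|re z| <= nrm z.
Proof. by rewrite nrmE -sqrtr_sqr ler_wsqrtr // lerDl sqr_ge0. Qed.

Lemma re_le_nrm z : re z <= nrm z.
Proof. exact: le_trans (ler_norm _) (ler_re_nrm _). Qed.

Lemma nrm_eq0 z : (nrm z == 0) = (z == 0).
Proof.
apply/eqP/eqP => [h|->]; last exact: nrm0.
by apply/normr0_eq0; rewrite nrm_norm h.
Qed.

Lemma nrm_gt0 z : (0 < nrm z) = (z != 0).
Proof. by rewrite lt_neqAle nrm_ge0 eq_sym nrm_eq0 andbT. Qed.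

Lemma nrmV z : nrm z^-1 = (nrm z)^-1.
Proof.
have [->|z0] := eqVneq z 0; first by rewrite invr0 nrm0 invr0.
have nz : nrm z != 0 by rewrite nrm_eq0.
by apply: (mulfI nz); rewrite -nrmM !divff // nrm1.
Qed.

Lemma nrm_div z w : nrm (z / w) = nrm z / nrm w.
Proof. by rewrite nrmM nrmV. Qed.

Lemma rotate z : exists u : cplx R, nrm u = 1 /\ u * z = of_real (nrm z).
Proof.
have [->|z0] := eqVneq z 0; first by exists 1; rewrite nrm1 mulr0 nrm0.
have nz : nrm z != 0 by rewrite nrm_eq0.
exists (of_real (nrm z) / z); rewrite divfK //; split=> //.
by rewrite nrm_div nrm_real ger0_norm ?nrm_ge0 // divff.
Qed.

Lemma re_iiM z : re (ii R * z) = - im z.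
Proof. by rewrite !cE; ring. Qed.

End Complex.

(** The radii of the norm topology are themselves elements of [cplx R]. Positivity in its order
    forces them to be real, so real radii suffice. *)
Lemma continuous_cplxP (R : realType) (X : topologicalType) (f : X -> cplx R) x :
  {for x, continuous f} <->
  forall e : R, 0 < e -> \forall z \near x, nrm (f x - f z) < e.
Proof.
split=> [fx e e0|h].
  have e0' : (0 : cplx R) < of_real e by rewrite /of_real ltcR.
  have /cvgrPdist_lt/(_ _ e0') := fx.
  apply: filterS => z /=; rewrite nrm_norm /of_real; by rewrite ltcR.
apply/cvgrPdist_lt => e e0.
have re0 : 0 < re e by move: e0; rewrite ltcE => /andP[].
have ee : e = of_real (re e).
  by apply: cplx_eq; rewrite ?cE //; move: e0; rewrite ltcE => /andP[/eqP].
apply: filterS (h _ re0) => z hz.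
by rewrite nrm_norm ee /of_real ltcR.
Qed.

Section ContinuousParts.
Variables (R : realType) (X : topologicalType) (f : X -> cplx R).
Hypothesis cf : continuous f.

Lemma continuous_re : continuous (fun x => re (f x)).
Proof.
move=> x; apply/cvgrPdist_lt => e e0.
have := (continuous_cplxP f x).1 (cf (x:=x)) _ e0; apply: filterS => z.
by apply: le_lt_trans; rewrite -reB ler_re_nrm.
Qed.

Lemma continuous_nrm : continuous (fun x => nrm (f x)).
Proof.
move=> x; apply/cvgrPdist_lt => e e0.
have := (continuous_cplxP f x).1 (cf (x:=x)) _ e0; apply: filterS => z.
apply: le_lt_trans; rewrite ler_norml lerB_nrm andbT.
by rewrite lerNl opprB nrm_distC lerB_nrm.
Qed.

End ContinuousParts.

(** * Uniform algebras *)

Section SupNorm.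
Variables (R : realType) (X : topologicalType).
Hypothesis compactX : compact [set: X].

Lemma supnorm_le (f : X -> cplx R) (c : R) :
  0 <= c -> (forall x, nrm (f x) <= c) -> supnorm f <= c.
Proof.
move=> c0 fc; rewrite /supnorm.
have [->|/set0P ne] := eqVneq [set complex.Re `|f x| | x in [set: X]] set0.
  by rewrite sup0.
by apply: ge_sup => // _ [x _ <-]; exact: fc.
Qed.

Lemma max_attained (g : X -> R) (F : set X) :
  closed F -> F !=set0 -> continuous g ->
  exists2 x, F x & forall z, F z -> g z <= g x.
Proof.
move=> clF ne cg.
have cF : compact F by apply: subclosed_compact clF compactX _.
have [//|x xF xmax] := compact_EVT_max ne cF (f := g).
  exact: continuous_subspaceT.
by exists x; [exact: set_mem|move=> z /mem_set; exact: xmax].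
Qed.

Lemma nrm_le_supnorm (f : X -> cplx R) x :
  continuous f -> nrm (f x) <= supnorm f.
Proof.
move=> cf.
have [//|z _ zmax] := max_attained (@closedT X) _ (continuous_nrm cf).
  by exists x.
apply: ub_le_sup; last by exists x.
by exists (nrm (f z)) => _ [t _ <-]; exact: zmax.
Qed.

Lemma supnorm_ge0 (f : X -> cplx R) : continuous f -> 0 <= supnorm f.
Proof.
move=> cf; have [[x _]|/set0P/negP/negPn/eqP e] := pselect ([set: X] !=set0).
  exact: le_trans (nrm_ge0 (f x)) (nrm_le_supnorm _ _).
by rewrite /supnorm e image_set0 sup0.
Qed.

Lemma supnorm_attained (f : X -> cplx R) :
  continuous f -> X -> exists x, nrm (f x) = supnorm f.
Proof.
move=> cf x0.
have [//|z _ zmax] := max_attained (@closedT X) _ (continuous_nrm cf).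
  by exists x0.
exists z; apply/eqP; rewrite eq_le nrm_le_supnorm // supnorm_le ?nrm_ge0 //.
by move=> t; exact: zmax.
Qed.

Lemma supnorm0_eq0 (f : X -> cplx R) : continuous f -> supnorm f = 0 -> f = 0.
Proof.
move=> cf f0; apply/funext => x; apply/eqP.
by rewrite -nrm_eq0 eq_le nrm_ge0 -f0 nrm_le_supnorm.
Qed.

Lemma supnorm0 : supnorm (0 : X -> cplx R) = 0.
Proof.
apply/eqP; rewrite eq_le supnorm_ge0 ?andbT; last by move=> x; exact: cvg_cst.
by apply: supnorm_le => // x; rewrite nrm0.
Qed.

End SupNorm.

Section UniformAlgebra.
Variables (R : realType) (X : topologicalType) (A : set (X -> cplx R)).
Hypotheses (compactX : compact [set: X]) (uaA : uniform_algebra A).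
Implicit Types f g : X -> cplx R.

Lemma ua_one : A 1. Proof. exact: ua_cst uaA 1. Qed.

Lemma ua_zero : A 0. Proof. exact: ua_cst uaA 0. Qed.

Lemma ua_opp f : A f -> A (- f).
Proof.
move=> Af; have -> : - f = (-1) *: f by rewrite scaleN1r.
exact: ua_scale.
Qed.

Lemma ua_sub f g : A f -> A g -> A (f - g).
Proof. by move=> Af Ag; apply: ua_add => //; exact: ua_opp. Qed.

Lemma ua_exp f n : A f -> A (f ^+ n).
Proof.
move=> Af; elim: n => [|n IH]; first by rewrite expr0; exact: ua_one.
by rewrite exprS; exact: ua_mul.
Qed.

Lemma ua_uniform_limit f :
  (forall e : R, 0 < e -> exists2 g, A g & forall x, nrm (f x - g x) < e) -> A f.
Proof.
move=> h; have := ua_closed uaA; apply.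
move=> U /uniform_nbhs [E [entE EU]].
have [e /= e0 he] : exists2 e : cplx R, 0 < e & forall u v, ball u e v -> E (u, v).
  by move: entE; rewrite -entourage_ballE => -[e e0 he]; exists e => // u v uv; exact: (he (u,v)).
have re0 : 0 < re e by move: e0; rewrite ltcE => /andP[].
have ee : e = of_real (re e).
  by apply: cplx_eq; rewrite ?cE //; move: e0; rewrite ltcE => /andP[/eqP].
have [g Ag hg] := h _ re0.
exists g; split=> //; apply: EU => x _ /=; apply: he.
by rewrite -ball_normE /ball_ /= nrm_norm ee /of_real ltcR.
Qed.

(** Geometric series: the partial sums lie in [A] and differ from the inverse by f^n / (1 - f), of
    modulus at most c^n / (1 - c). *)
Lemma ua_neumann f (c : R) : A f -> c < 1 -> (forall x, nrm (f x) <= c) ->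
  A (fun x => (1 - f x)^-1).
Proof.
move=> Af c1 fc; have [[x0 _]|nX] := pselect ([set: X] !=set0); last first.
  apply: ua_uniform_limit => e e0; exists 0; first exact: ua_zero.
  by move=> x; exfalso; apply: nX; exists x.
have c0 : 0 <= c := le_trans (nrm_ge0 _) (fc x0).
have d0 : 0 < 1 - c by rewrite subr_gt0.
have lb x : 1 - c <= nrm (1 - f x).
  by apply: le_trans (lerB_nrm _ _); rewrite nrm1 lerD2l lerN2.
have nz x : 1 - f x != 0 by rewrite -nrm_gt0 (lt_le_trans d0).
apply: ua_uniform_limit => e e0.
have [n cn] : exists n, c ^+ n < e * (1 - c).
  have := @cvg_expr R c; rewrite ger0_norm // => /(_ c1)/cvgrPdist_lt.
  move=> /(_ (e * (1 - c)) (mulr_gt0 e0 d0)) [n _ /(_ n (leqnn _))] /=.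
  by rewrite sub0r normrN ger0_norm ?exprn_ge0 // => ?; exists n.
exists (\sum_(i < n) f ^+ i).
  elim/big_ind: _ => [|g k Ag Ak|i _]; [exact: ua_zero|exact: ua_add|exact: ua_exp].
move=> x.
have E : (\sum_(i < n) f ^+ i) x = \sum_(i < n) f x ^+ i.
  rewrite fct_sumE; apply: eq_bigr => i _.
  by elim: (nat_of_ord i) => [|k IH]; rewrite ?expr0 // !exprS /= -IH.
have -> : (1 - f x)^-1 - (\sum_(i < n) f ^+ i) x = f x ^+ n / (1 - f x).
  apply: (mulIf (nz x)); rewrite mulrBl mulVf // divfK // E.
  have := subrX1 (f x) n; rewrite mulrC -opprB => /(congr1 -%R).
  by rewrite -mulrN !opprB => <-; rewrite opprB addrCA subrr addr0.
rewrite nrm_div nrmX ltr_pdivrMr ?nrm_gt0 //.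
apply: le_lt_trans (lt_le_trans cn _); first by rewrite lerXn2r ?nnegrE ?nrm_ge0.
by rewrite ler_pM2l.
Qed.

Lemma ua_inv_sub f : ua_inv A f -> A f. Proof. by case. Qed.

Lemma ua_inv_neq0 f x : ua_inv A f -> f x != 0.
Proof.
move=> [_ [g _ /(congr1 (@^~ x)) fg]]; apply/eqP => f0; move: fg.
rewrite /GRing.mul /= f0 mul0r => /eqP; by rewrite eq_sym oner_eq0.
Qed.

Lemma ua_invP f :
  ua_inv A f <-> [/\ A f, forall x, f x != 0 & A (fun x => (f x)^-1)].
Proof.
split=> [fi|[Af f0 Af1]].
  split; [exact: ua_inv_sub|by move=> x; exact: ua_inv_neq0|].
  have [Af [g Ag fg]] := fi.
  suff <- : g = (fun x => (f x)^-1) by [].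
  apply/funext => x; have f0 := ua_inv_neq0 x fi.
  apply: (mulfI f0); rewrite divff //.
  exact: (congr1 (@^~ x) fg).
split=> //; exists (fun x => (f x)^-1) => //.
by apply/funext => x; exact: (divff (f0 x)).
Qed.

Lemma ua_inv_inv f : ua_inv A f -> ua_inv A (fun x => (f x)^-1).
Proof.
move=> /ua_invP[Af f0 Af1]; apply/ua_invP; split=> //.
  by move=> x; rewrite invr_eq0.
suff -> : (fun x => (f x)^-1^-1) = f by [].
by apply/funext => x; rewrite invrK.
Qed.

Lemma ua_inv_mul f g : ua_inv A f -> ua_inv A g -> ua_inv A (f * g).
Proof.
move=> /ua_invP[Af f0 Af1] /ua_invP[Ag g0 Ag1]; apply/ua_invP; split.
- exact: ua_mul.
- by move=> x; rewrite /GRing.mul /= mulf_neq0.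
have -> : (fun x => ((f * g) x)^-1) = (fun x => (f x)^-1) * (fun x => (g x)^-1).
  by apply/funext => x; rewrite /GRing.mul /= invfM.
exact: ua_mul.
Qed.

Lemma ua_inv_cst (c : cplx R) : c != 0 -> ua_inv A (cst c).
Proof. by move=> c0; apply/ua_invP; split=> //; exact: ua_cst. Qed.

Lemma ua_inv_one : ua_inv A 1.
Proof. by apply: ua_inv_cst; rewrite oner_eq0. Qed.

Lemma ua_inv_near (c : cplx R) (r : R) f : A f -> c != 0 -> r < 1 ->
  (forall x, nrm (1 - f x / c) <= r) -> ua_inv A f.
Proof.
move=> Af c0 r1 fr.
have Ag : A (fun x => (f x / c)^-1).
  have -> : (fun x => (f x / c)^-1) = (fun x => (1 - (1 - (c^-1 *: f) x))^-1).
    apply/funext => x; rewrite opprB addrC subrK.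
    by rewrite -[RHS]/((c^-1 * f x)^-1) mulrC.
  apply: (@ua_neumann (1 - c^-1 *: f) r) => //.
    by apply: ua_sub; [exact: ua_one|exact: ua_scale].
  move=> x; apply: le_trans (fr x); rewrite le_eqVlt; apply/orP; left; apply/eqP.
  by congr nrm; rewrite [f x / c]mulrC.
apply/ua_invP; split=> //.
- move=> x; apply/eqP => f0; have := fr x.
  by rewrite f0 mul0r subr0 nrm1 leNgt r1.
have -> : (fun x => (f x)^-1) = c^-1 *: (fun x => (f x / c)^-1).
  apply/funext => x.
  rewrite -[RHS]/(c^-1 * (f x / c)^-1) invfM invrK.
  by rewrite mulrC -mulrA divff ?mulr1.
exact: ua_scale.
Qed.

Lemma ua_inv_addcst f (c : cplx R) (r : R) : A f -> r < nrm c ->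
  (forall x, nrm (f x) <= r) -> ua_inv A (f + cst c).
Proof.
move=> Af rc fr; have [[x0 _]|nX] := pselect ([set: X] !=set0); last first.
  apply: (@ua_inv_near 1 0) => //.
  - by apply: ua_add => //; exact: ua_cst.
  - by move=> x; exfalso; apply: nX; exists x.
have r0 : 0 <= r := le_trans (nrm_ge0 _) (fr x0).
have c0 : 0 < nrm c := le_lt_trans r0 rc.
have cn0 : c != 0 by rewrite -nrm_gt0.
apply: (@ua_inv_near c (r / nrm c)) => //.
- by apply: ua_add => //; exact: ua_cst.
- by rewrite ltr_pdivrMr // mul1r.
move=> x; have -> : 1 - (f + cst c) x / c = - (f x / c).
  by rewrite [(f + cst c) x]/(f x + c) mulrDl divff // opprD addrCA subrr addr0.
by rewrite nrmN nrm_div ler_pM2r ?invr_gt0.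
Qed.

(** The values of 1 - f form a bounded set in the half-plane re >= 1, so they lie in a disc about a
    large real [c] that stays away from 0, and [ua_inv_near] applies. *)
Lemma ua_inv_one_sub f : A f -> (forall x, re (f x) <= 0) -> ua_inv A (1 - f).
Proof.
move=> Af fneg; set m := supnorm f.
have fm x : nrm (f x) <= m by apply: nrm_le_supnorm => //; exact: ua_continuous Af.
have m0 : 0 <= m by apply: supnorm_ge0 => //; exact: ua_continuous Af.
(* Since m^2 = c - 1, (c - 1)^2 + m^2 = c^2 - c, so that [q] below is 1 - 1 / c. *)
set c := 1 + m ^+ 2.
have c1 : 1 <= c by rewrite lerDl sqr_ge0.
have c0 : 0 < c by apply: lt_le_trans c1.
have cn0 : of_real c != 0 :> cplx R by rewrite -nrm_gt0 nrm_real gtr0_norm.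
set q := ((c - 1) ^+ 2 + m ^+ 2) / c ^+ 2.
have q1 : q < 1.
  rewrite ltr_pdivrMr ?exprn_gt0 // mul1r /c; nra.
have q0 : 0 <= q by rewrite divr_ge0 ?addr_ge0 ?sqr_ge0.
apply: (@ua_inv_near (of_real c) (Num.sqrt q)) => //.
- by apply: ua_sub => //; exact: ua_one.
- by rewrite -sqrtr1 ltr_sqrt.
move=> x.
have -> : 1 - (1 - f) x / of_real c = (of_real (c - 1) + f x) / of_real c.
  apply: (mulIf cn0); rewrite mulrBl !divfK // mul1r.
  rewrite [(1 - f) x]/(1 - f x).
  have -> : of_real (c - 1) = of_real c - 1 :> cplx R.
    by apply: cplx_eq; rewrite !cE ?subr0.
  by rewrite opprB addrCA addrC.
rewrite -[leLHS]ger0_norm ?nrm_ge0 // -sqrtr_sqr ler_wsqrtr //.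
rewrite nrm_div expr_div_n nrm_real gtr0_norm // /q.
rewrite ler_pM2r ?invr_gt0 ?exprn_gt0 // nrm_sqr !cE.
have := nrm_sqr (f x); have := fm x; have := nrm_ge0 (f x); have := fneg x.
move: (re (f x)) (im (f x)) (nrm (f x)) => a b n.
move=> a0 n0 nm nn.
have : n ^+ 2 <= m ^+ 2 by rewrite lerXn2r ?nnegrE.
rewrite nn add0r; nra.
Qed.

End UniformAlgebra.

(** * The Hahn-Banach theorem *)

Section HahnBanach.
Variables (R : realType) (V : lmodType (cplx R)) (W : set V).
Hypotheses (WD : forall x y, W x -> W y -> W (x + y))
           (WZ : forall c x, W x -> W (c *: x)).
Implicit Types (x y : V).

(** The algebra is a set of functions, so functionals are defined on all of [V] and only their
    values on the subspace [W] count. Scalars are real inside a complex module; [sublinZ] is one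
    inequality, and [sublinZ_ge] recovers the other. *)
Record sublinear_on (p : V -> R) : Prop := SublinearOn {
  sublinD : forall x y, W x -> W y -> p (x + y) <= p x + p y ;
  sublinZ : forall (t : R) x, 0 <= t -> W x -> p (of_real t *: x) <= t * p x }.

Record real_linear_on (p : V -> R) : Prop := RealLinearOn {
  rlinD : forall x y, W x -> W y -> p (x + y) = p x + p y ;
  rlinZ : forall (t : R) x, W x -> p (of_real t *: x) = t * p x }.

Lemma WN x : W x -> W (- x).
Proof. by move=> Wx; rewrite -scaleN1r; exact: WZ. Qed.

Lemma sublin0 (p : V -> R) x : W x -> sublinear_on p -> 0 <= p x + p (- x).
Proof.
move=> Wx sp.
have W0 : W 0 by rewrite -(scale0r x); exact: WZ.
have := sublinD sp Wx (WN Wx); rewrite subrr.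
have := sublinD sp W0 W0; rewrite addr0; lra.
Qed.

Lemma sublinZ_ge (p : V -> R) (t : R) x : 0 <= t -> W x -> sublinear_on p ->
  t * p x <= p (of_real t *: x).
Proof.
move=> t0 Wx sp; have [->|tn0] := eqVneq t 0.
  rewrite mul0r /of_real scale0r.
  have W0 : W 0 by rewrite -(scale0r x); exact: WZ.
  have := sublinD sp W0 W0; rewrite addr0.
  lra.
have tp : 0 < t by rewrite lt_neqAle eq_sym tn0.
have tV0 : 0 <= t^-1 by rewrite invr_ge0.
have := sublinZ sp tV0 (WZ (of_real t) Wx).
rewrite scalerA -of_realM mulVf // scale1r => h.
by rewrite -(ler_pM2l (x := t^-1)) ?invr_gt0 // mulrA mulVf // mul1r.
Qed.

(** The infimum over this set is a sublinear minorant of [q] as a function of [v]. Its term t = 1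
    makes a minimal [q] additive. *)
Let shift (q : V -> R) x v := [set q (v + of_real t *: x) - t * q x | t in [set t : R | 0 <= t]].

Lemma shift_lb q x v : sublinear_on q -> W x -> W v ->
  lbound (shift q x v) (- q (- v)).
Proof.
move=> sq Wx Wv _ [t /= t0 <-].
have Wtx := WZ (of_real t) Wx.
have := sublinD sq (WD Wv Wtx) (WN Wv).
rewrite addrAC subrr add0r; have := sublinZ_ge t0 Wx sq; lra.
Qed.

Lemma shift_sublinear q x : sublinear_on q -> W x ->
  sublinear_on (fun v => inf (shift q x v)).
Proof.
move=> sq Wx.
have shle v t : W v -> 0 <= t -> inf (shift q x v) <= q (v + of_real t *: x) - t * q x.
  move=> Wv t0; apply: ge_inf; last by exists t.
  by exists (- q (- v)); exact: shift_lb.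
have leinf v c : (forall t : R, 0 <= t -> c <= q (v + of_real t *: x) - t * q x) ->
    c <= inf (shift q x v).
  move=> h; apply: lb_le_inf; last by move=> _ [t /= t0 <-]; exact: h.
  by exists (q (v + of_real 0 *: x) - 0 * q x), 0 => /=.
have WtD v t : W v -> W (v + of_real t *: x).
  by move=> Wv; apply: WD => //; exact: WZ.
split=> [u v Wu Wv|a v a0 Wv].
  rewrite -lerBlDr; apply: (leinf) => t t0; rewrite lerBlDr -lerBlDl.
  apply: (leinf) => r r0; rewrite lerBlDl.
  apply: le_trans (shle _ (r + t) (WD Wu Wv) (addr_ge0 r0 t0)) _.
  have := sublinD sq (WtD _ r Wv) (WtD _ t Wu).
  have -> : v + of_real r *: x + (u + of_real t *: x) =
            u + v + of_real (r + t) *: x.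
    by rewrite of_realD scalerDl addrACA [v + u]addrC.
  lra.
have [->|an0] := eqVneq a 0.
  rewrite mul0r /of_real scale0r.
  have W0 : W 0 by rewrite -(scale0r x); exact: WZ.
  apply: le_trans (shle 0 0 W0 (lexx _)) _.
  rewrite /of_real scale0r addr0 mul0r subr0.
  by have := sublinZ sq (lexx 0) Wx; rewrite /of_real scale0r mul0r.
have ap : 0 < a by rewrite lt_neqAle eq_sym an0.
rewrite -ler_pdivrMl //; apply: (leinf) => t t0; rewrite ler_pdivrMl //.
apply: le_trans (shle _ (a * t) (WZ _ Wv) (mulr_ge0 a0 t0)) _.
have := sublinZ sq a0 (WtD v t Wv).
rewrite scalerDr scalerA -of_realM; lra.
Qed.

(** A minimal sublinear functional m below [p] is linear: by minimality it is at most its own shift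
    along any x, whose term t = 1 gives m y <= m (x + y) - m x. *)
Lemma hahn_banach (p : V -> R) : sublinear_on p ->
  exists2 s, real_linear_on s & forall x, W x -> s x <= p x.
Proof.
move=> sp; pose P (q : V -> R) := sublinear_on q /\ forall x, W x -> q x <= p x.
pose D := {q | P q}; pose mkD q sq qp : D := exist P q (conj sq qp).
(* The order is reversed, so that maximal elements are minimal functionals. It is only a preorder,
   since values outside [W] are ignored. *)
pose le (q1 q2 : D) := `[< forall x, W x -> sval q2 x <= sval q1 x >].
pose p0 := mkD p sp (fun x _ => lexx (p x)).
have chain (C : set D) : total_on C (fun q1 q2 => le q1 q2) ->
    exists t, forall s, C s -> le s t.
  move=> totC; have [[q0 Cq0]|nC] := pselect (C !=set0); last first.
    by exists p0 => s Cs; exfalso; apply: nC; exists s.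
  pose Q x := [set sval q x | q in C].
  have lbQ x : W x -> lbound (Q x) (- p (- x)).
    move=> Wx _ [[q [sq qp]] Cq <-] /=.
    have := sublin0 Wx sq; have := qp _ (WN Wx); lra.
  have infle x q : W x -> C q -> inf (Q x) <= sval q x.
    move=> Wx Cq; apply: ge_inf; last by exists q.
    by exists (- p (- x)); exact: lbQ.
  have leinf x c : (forall q, C q -> c <= sval q x) -> c <= inf (Q x).
    move=> h; apply: lb_le_inf; last by move=> _ [q Cq <-]; exact: h.
    by exists (sval q0 x), q0.
  have sQ : sublinear_on (fun x => inf (Q x)).
    split=> [x y Wx Wy|t x t0 Wx].
      rewrite -lerBlDr; apply: (leinf) => q1 Cq1; rewrite lerBlDr -lerBlDl.
      apply: (leinf) => q2 Cq2; rewrite lerBlDl.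
      case: (totC _ _ Cq1 Cq2) => /asboolP h.
        apply: le_trans (infle _ _ (WD Wx Wy) Cq2) _.
        have := sublinD (proj1 (svalP q2)) Wx Wy; have := h _ Wx; lra.
      apply: le_trans (infle _ _ (WD Wx Wy) Cq1) _.
      have := sublinD (proj1 (svalP q1)) Wx Wy; have := h _ Wy; lra.
    have [t00|tn0] := eqVneq t 0.
      apply: le_trans (infle _ _ (WZ _ Wx) Cq0) _.
      apply: le_trans (sublinZ (proj1 (svalP q0)) t0 Wx) _.
      by rewrite t00 !mul0r.
    have tp : 0 < t by rewrite lt_neqAle eq_sym tn0.
    rewrite -ler_pdivrMl //; apply: (leinf) => q Cq; rewrite ler_pdivrMl //.
    apply: le_trans (infle _ _ (WZ _ Wx) Cq) _.
    by have [sq _] := svalP q; have := sublinZ sq t0 Wx.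
  have Qp x : W x -> inf (Q x) <= p x.
    move=> Wx; apply: le_trans (infle _ _ Wx Cq0) _.
    exact: (proj2 (svalP q0)).
  exists (mkD _ sQ Qp) => s Cs; apply/asboolP => x Wx /=.
  exact: infle.
have lexx' q : le q q by apply/asboolP => x _.
have letr q r s : le q r -> le r s -> le q s.
  move=> /asboolP qr /asboolP rs; apply/asboolP => x Wx.
  exact: le_trans (rs _ Wx) (qr _ Wx).
have [[m [sm mp]] mmax] := ZL_preorder p0 lexx' letr chain.
have addm x y : W x -> W y -> m (x + y) = m x + m y.
  move=> Wx Wy; apply/eqP; rewrite eq_le (sublinD sm) //=.
  have s' := shift_sublinear sm Wx.
  have infm v t : W v -> 0 <= t -> inf (shift m x v) <= m (v + of_real t *: x) - t * m x.
    move=> Wv t0; apply: ge_inf; last by exists t.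
    by exists (- m (- v)); exact: shift_lb.
  have m'm v : W v -> inf (shift m x v) <= m v.
    by move=> Wv; have := infm v 0 Wv (lexx _); rewrite /of_real scale0r addr0 mul0r subr0.
  have m'p v : W v -> inf (shift m x v) <= p v.
    by move=> Wv; apply: le_trans (m'm v Wv) (mp _ Wv).
  have /mmax : le (mkD m sm mp) (mkD _ s' m'p).
    by apply/asboolP => v Wv /=; exact: m'm.
  move=> /asboolP/(_ y Wy) /= h.
  have := infm y 1 Wy ler01; rewrite /of_real scale1r mul1r [y + x]addrC; lra.
exists m => //; split=> // t x Wx.
have mN z : W z -> m (- z) = - m z.
  move=> Wz; have W0 : W 0 by rewrite -(scale0r x); exact: WZ.
  have := addm _ _ W0 W0; have := addm _ _ Wz (WN Wz); rewrite subrr addr0; lra.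
have pos r z : 0 <= r -> W z -> m (of_real r *: z) = r * m z.
  by move=> r0 Wz; apply/eqP; rewrite eq_le (sublinZ sm) // sublinZ_ge.
have [t0|t0] := leP 0 t; first exact: pos.
have := pos (- t) x; rewrite oppr_ge0 => /(_ (ltW t0) Wx).
rewrite of_realN scaleNr mN ?mulNr; last exact: WZ.
by move=> /oppr_inj.
Qed.

(* Applied to the infimal convolution of [a] and [- b]. *)
Lemma sandwich (a b : V -> R) : W 0 -> sublinear_on a ->
  sublinear_on (fun x => - b x) -> (forall x, W x -> b x <= a x) ->
  exists s, real_linear_on s /\ forall x, W x -> b x <= s x <= a x.
Proof.
move=> W0 sa sb ba.
pose Q f := [set a (f + g) - b g | g in W].
have lbQ f : W f -> lbound (Q f) (- a (- f)).
  move=> Wf _ [g Wg <-].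
  have := sublinD sa (WD Wf Wg) (WN Wf); rewrite addrAC subrr add0r.
  have := ba _ Wg; lra.
have infle f g : W f -> W g -> inf (Q f) <= a (f + g) - b g.
  move=> Wf Wg; apply: ge_inf; last by exists g.
  by exists (- a (- f)); exact: lbQ.
have leinf f c : (forall g, W g -> c <= a (f + g) - b g) -> c <= inf (Q f).
  move=> h; apply: lb_le_inf; last by move=> _ [g Wg <-]; exact: h.
  by exists (a (f + 0) - b 0), 0.
have a0 : a 0 <= 0.
  by have := sublinZ sa (lexx 0) W0; rewrite /of_real scale0r mul0r.
have b0 : 0 <= b 0.
  by have := sublinZ sb (lexx 0) W0; rewrite /of_real scale0r mul0r; lra.
have sQ : sublinear_on (fun f => inf (Q f)).
  split=> [x y Wx Wy|t x t0 Wx].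
    rewrite -lerBlDr; apply: (leinf) => g Wg; rewrite lerBlDr -lerBlDl.
    apply: (leinf) => h Wh; rewrite lerBlDl.
    apply: le_trans (infle _ (g + h) (WD Wx Wy) (WD Wg Wh)) _.
    have := sublinD sa (WD Wx Wg) (WD Wy Wh); rewrite addrACA.
    have := sublinD sb Wg Wh; lra.
  have [t00|tn0] := eqVneq t 0.
    rewrite t00 mul0r /of_real scale0r.
    by apply: le_trans (infle 0 0 W0 W0) _; rewrite addr0; lra.
  have tp : 0 < t by rewrite lt_neqAle eq_sym tn0.
  rewrite -ler_pdivrMl //; apply: (leinf) => g Wg; rewrite ler_pdivrMl //.
  apply: le_trans (infle _ (of_real t *: g) (WZ _ Wx) (WZ _ Wg)) _.
  have := sublinZ sa t0 (WD Wx Wg); rewrite scalerDr.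
  have := sublinZ sb t0 Wg; lra.
have [s ls sle] := hahn_banach sQ.
exists s; split=> // x Wx; apply/andP; split; last first.
  by apply: le_trans (sle _ Wx) _; apply: le_trans (infle x 0 Wx W0) _; rewrite addr0; lra.
(* The infimum at - x, with g = x, gives - s x <= a 0 - b x. *)
have := sle _ (WN Wx); have := infle _ _ (WN Wx) Wx.
rewrite addNr -[- x]scaleN1r -of_real1 -of_realN (rlinZ ls) //; lra.
Qed.

End HahnBanach.

(** * States and the Choquet boundary *)

Section CompactMinimal.
Variables (X : topologicalType).
Hypothesis compactX : compact [set: X].

(** Otherwise the sets F \ U generate a proper filter, and a cluster point of it lies in every F but
    not in U. *)
Lemma chain_capture (C : set (set X)) (U : set X) :
  C !=set0 -> (forall F, C F -> closed F) -> total_on C subset ->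
  open U -> \bigcap_(F in C) F `<=` U -> exists2 F, C F & F `<=` U.
Proof.
move=> [F0 CF0] clC totC oU CU; apply: contrapT => nex.
have ne F : C F -> F `\` U !=set0.
  move=> CF; apply: contrapT => h; apply: nex; exists F => // z Fz.
  by apply: contrapT => nUz; apply: h; exists z.
pose B := filter_from C (fun F => F `\` U).
have PB : ProperFilter B.
  apply: filter_from_proper => //; apply: filter_from_filter; first by exists F0.
  move=> F G CF CG; case: (totC _ _ CF CG) => FG.
    by exists F => // z [Fz Uz]; split; split=> //; exact: FG.
  by exists G => // z [Fz Uz]; split; split=> //; exact: FG.
have [|x [_ clx]] := compactX PB; first by exists F0.
have inFU F : C F -> (F `\` U) x.
  move=> CF; have clFU : closed (F `\` U).
    by apply: closedI; [exact: clC|exact: open_closedC].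
  by apply: clFU => V nV; apply: clx => //; exists F.
have [_] := inFU _ CF0; apply; apply: CU => F CF.
by have [] := inFU _ CF.
Qed.

(** Zorn's lemma for reverse inclusion. It serves for nonempty absorbing sets and for sets
    supporting an evaluation. *)
Lemma minimal_closed (P : set (set X)) (F0 : set X) :
  closed F0 -> P F0 ->
  (forall C : set (set X), C !=set0 -> (forall F, C F -> closed F /\ P F) ->
     total_on C subset -> P (\bigcap_(F in C) F)) ->
  exists F, [/\ F `<=` F0, closed F, P F &
    forall G, G `<=` F -> closed G -> P G -> F `<=` G].
Proof.
move=> cl0 P0 chainP.
pose Q F := [/\ closed F, P F & F `<=` F0]; pose D := {F | Q F}.
pose le (F G : D) := `[< sval G `<=` sval F >].
have Q0 : Q F0 by split.
have le_refl F : le F F by apply/asboolP.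
have le_tr F G H : le F G -> le G H -> le F H.
  move=> /asboolP FG /asboolP GH; apply/asboolP.
  exact: subset_trans GH FG.
have le_chain (C : set D) : total_on C (fun F G => le F G) ->
    exists F, forall G, C G -> le G F.
  move=> totC; have [[F1 CF1]|nC] := pselect (C !=set0); last first.
    by exists (exist _ _ Q0) => s Cs; exfalso; apply: nC; exists s.
  pose C' : set (set X) := [set sval F | F in C].
  have QC : Q (\bigcap_(F in C') F).
    split.
    - by apply: closed_bigI => _ [F _ <-]; have [] := svalP F.
    - apply: chainP.
      + by exists (sval F1), F1.
      + by move=> _ [F _ <-]; have [] := svalP F.
      + move=> _ _ [F CF <-] [G CG <-].
        by case: (totC _ _ CF CG) => /asboolP; [right|left].
    - move=> z Cz; have [_ _ F10] := svalP F1; apply: F10.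
      by apply: Cz; exists F1.
  exists (exist _ _ QC) => F CF; apply/asboolP => z /= /(_ (sval F)); apply.
  by exists F.
have [[F [clF PF F_0]] Fmax] := ZL_preorder (exist _ _ Q0) le_refl le_tr le_chain;
 exists F; split=> // G GF clG PG.
have QG : Q G by split=> //; exact: (subset_trans GF F_0).
by have /Fmax/asboolP : le (exist _ F (And3 clF PF F_0)) (exist _ _ QG) by apply/asboolP.
Qed.

End CompactMinimal.

(** * Functionals supported by a set, and their complexification *)

Section Choquet.
Variables (R : realType) (X : topologicalType) (A : set (X -> cplx R)).
Hypotheses (compactX : compact [set: X]) (uaA : uniform_algebra A).
Implicit Types f g : X -> cplx R.
Implicit Types s : (X -> cplx R) -> R.

Let AD f g : A f -> A g -> A (f + g). Proof. exact: ua_add. Qed.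
Let AZ (c : cplx R) f : A f -> A (c *: f). Proof. exact: ua_scale. Qed.

(** For a state and a closed [F] this stands for having a representing measure on [F]. Applied to 1
    and - 1 it normalises a linear [s]. *)
Definition supported s (F : set X) :=
  forall f (c : R), A f -> (forall z, F z -> re (f z) <= c) -> s f <= c.

Definition pt_re (x : X) f := re (f x).

Lemma ua_continuous_re f : A f -> continuous (fun x => re (f x)).
Proof. by move=> Af; apply: continuous_re; exact: ua_continuous Af. Qed.

Lemma supported_sub s F G : F `<=` G -> supported s F -> supported s G.
Proof. by move=> FG sF f c Af fc; apply: sF => // z /FG; exact: fc. Qed.

Lemma pt_re_linear x : real_linear_on A (pt_re x).
Proof.
split=> [f g _ _|t f _]; first exact: reD.
by rewrite /pt_re -[(of_real t *: f) x]/(of_real t * f x) !cE mul0r subr0.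
Qed.

(** If re f < c + e on the intersection, then by compactness also on one member of the chain. *)
Lemma chain_supported s (C : set (set X)) :
  C !=set0 -> (forall F, C F -> closed F) -> total_on C subset ->
  (forall F, C F -> supported s F) -> supported s (\bigcap_(F in C) F).
Proof.
move=> C0 clC totC sC f c Af fc; apply/ler_addgt0Pr => e e0.
have [||F CF Fe] := @chain_capture _ compactX C [set z | re (f z) < c + e] C0 clC totC.
- have -> : [set z | re (f z) < c + e] = (fun z => re (f z)) @^-1` [set r | r < c + e].
    by [].
  apply: open_comp; first by move=> z _; exact: ua_continuous_re.
  exact: open_lt.
- by move=> z /fc /= h; rewrite ltr_pwDr.
- by apply: (sC F) => // z /Fe /ltW.
Qed.

Lemma state0 (L : (X -> cplx R) -> cplx R) : is_state A L -> L 0 = 0.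
Proof.
move=> sL; have := state_linear sL 1 (ua_zero uaA) (ua_zero uaA).
rewrite scale1r addr0 mul1r => /eqP.
by rewrite -[X in X == _]addr0 (inj_eq (addrI _)) eq_sym => /eqP.
Qed.

Lemma stateZ (L : (X -> cplx R) -> cplx R) c f :
  is_state A L -> A f -> L (c *: f) = c * L f.
Proof.
move=> sL Af; have := state_linear sL c Af (ua_zero uaA).
by rewrite addr0 (state0 sL) addr0.
Qed.

Lemma stateD (L : (X -> cplx R) -> cplx R) f g :
  is_state A L -> A f -> A g -> L (f + g) = L f + L g.
Proof.
move=> sL Af Ag; have := state_linear sL 1 Af Ag.
by rewrite scale1r mul1r.
Qed.

Lemma state_real_linear (L : (X -> cplx R) -> cplx R) :
  is_state A L -> real_linear_on A (fun f => re (L f)).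
Proof.
move=> sL; split=> [f g Af Ag|t f Af]; first by rewrite stateD // reD.
by rewrite stateZ // !cE mul0r subr0.
Qed.

(* Comparing with the norm of [f - c + r] for large [r]. *)
Lemma state_supported (L : (X -> cplx R) -> cplx R) :
  is_state A L -> supported (fun f => re (L f)) setT.
Proof.
move=> sL f c Af fc; set g := f - cst (of_real c).
have Ag : A g by apply: ua_sub => //; exact: ua_cst.
set m := supnorm g.
have gm x : nrm (g x) <= m by apply: nrm_le_supnorm => //; exact: ua_continuous Ag.
have m0 : 0 <= m by apply: supnorm_ge0 => //; exact: ua_continuous Ag.
have L1 (a : cplx R) : L (cst a) = a.
  have -> : cst a = a *: (1 : X -> cplx R).
    by apply/funext => x; rewrite -[RHS]/(a * 1) mulr1.
  by rewrite stateZ ?(state_one sL) ?mulr1 //; exact: ua_one.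
have key (r : R) : 0 < r -> re (L f) - c <= m ^+ 2 / (2 * r).
  move=> r0; have Ac : A (cst (of_real r)) by exact: ua_cst.
  have := state_norm sL (ua_add uaA Ag Ac).
  have : supnorm (g + cst (of_real r)) <= r + m ^+ 2 / (2 * r).
    have d0 : 0 <= m ^+ 2 / (2 * r) by rewrite divr_ge0 ?sqr_ge0 // mulr_ge0 // ltW.
    apply: supnorm_le => //; first by rewrite addr_ge0 // ltW.
    move=> x; rewrite -[leLHS]ger0_norm ?nrm_ge0 // -[leRHS]ger0_norm; last first.
      by rewrite addr_ge0 // ltW.
    rewrite -ler_sqr ?nnegrE ?normr_ge0 // !real_normK ?num_real // nrm_sqr.
    rewrite -[(g + _) x]/(g x + of_real r).
    have gx : re (g x) <= 0.
      by rewrite -[g x]/(f x - of_real c) !cE subr_le0; exact: fc.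
    have gm2 : nrm (g x) ^+ 2 <= m ^+ 2 by rewrite lerXn2r ?nnegrE ?nrm_ge0.
    move: (g x) gx gm2 => w w0 wm; have := nrm_sqr w; rewrite !cE addr0.
    have -> : (r + m ^+ 2 / (2 * r)) ^+ 2 = r ^+ 2 + m ^+ 2 + (m ^+ 2 / (2 * r)) ^+ 2.
      by field; rewrite gt_eqF.
    have := sqr_ge0 (m ^+ 2 / (2 * r)).
    have ar : re w * r <= 0 by rewrite mulr_le0_ge0 // ltW.
    rewrite sqrrD; lra.
  move=> h1 h2; have := le_trans h2 h1; move=> /(le_trans (re_le_nrm _)).
  rewrite stateD // L1 !cE.
  have -> : L g = L f - of_real c.
    have -> : g = (-1) *: cst (of_real c) + f.
      by rewrite scaleN1r addrC.
    rewrite (state_linear sL) ?L1 ?mulN1r 1?addrC; [by []|exact: ua_cst|by []].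
  rewrite !cE; lra.
rewrite -subr_le0; apply/ler_addgt0Pr => e e0; rewrite add0r.
have [m00|mn0] := eqVneq m 0.
  by have := key 1 ltr01; rewrite m00 expr0n /= mul0r => /le_trans; apply; exact: ltW.
have mp : 0 < m ^+ 2 by rewrite exprn_gt0 // lt_neqAle eq_sym mn0.
(* Taken for [r] in [key], this number makes the error m^2 / (2 r) equal to e. *)
have r0 : 0 < m ^+ 2 / (2 * e) by rewrite divr_gt0 // mulr_gt0.
have := key _ r0.
suff -> : m ^+ 2 / (2 * (m ^+ 2 / (2 * e))) = e by [].
field; rewrite ?gt_eqF //=; lra.
Qed.

(** The complex-linear functional with real part [s]: its imaginary part at f is minus its real part
    at i f. *)
Definition complexify s f : cplx R := Complex (s f) (- s (ii R *: f)).

Lemma rlin0 s : real_linear_on A s -> s 0 = 0.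
Proof. by move=> ls; have := rlinZ ls 0 (ua_zero uaA); rewrite /of_real scale0r mul0r. Qed.

Lemma rlinN s f : real_linear_on A s -> A f -> s (- f) = - s f.
Proof.
move=> ls Af; have := rlinZ ls (-1) Af.
by rewrite of_realN scaleNr scale1r mulN1r.
Qed.

(** For the norm bound, a unimodular u turns the value at f into its modulus, which is then s (u f),
    and re (u f) is at most the norm of f. *)
Lemma complexify_state s F : real_linear_on A s -> supported s F ->
  is_state A (complexify s).
Proof.
move=> ls sF.
have A1 := ua_one uaA.
have lin (c : cplx R) f g : A f -> A g ->
    complexify s (c *: f + g) = c * complexify s f + complexify s g.
  move=> Af Ag.
  have cE1 (c' : cplx R) h : A h -> s (c' *: h) = re c' * s h + im c' * s (ii R *: h).
    move=> Ah; have -> : c' *: h = of_real (re c') *: h + of_real (im c') *: (ii R *: h).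
      rewrite scalerA -scalerDl; congr (_ *: _).
      by apply: cplx_eq; rewrite !cE; ring.
    have Aih := AZ (ii R) Ah.
    by rewrite (rlinD ls (AZ _ Ah) (AZ _ Aih)) !(rlinZ ls).
  apply: cplx_eq; rewrite !cE /complexify /re /im /= -/(re c) -/(im c).
    by rewrite (rlinD ls (AZ _ Af) Ag) cE1 //; ring.
  rewrite scalerDr scalerA (rlinD ls (AZ _ Af) (AZ _ Ag)).
  rewrite cE1 // !cE; ring.
split=> //.
  have s1 : s 1 <= 1 by apply: sF => // z _.
  have sN1 : s (- 1) <= -1 by apply: sF => //; exact: ua_opp.
  have si : s (ii R *: (1 : X -> cplx R)) <= 0.
    by apply: sF => [|z _]; [exact: AZ|rewrite -[(_ *: _) z]/(ii R * 1) mulr1].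
  have sNi : s (- (ii R *: (1 : X -> cplx R))) <= 0.
    apply: sF => [|z _]; first by apply: ua_opp => //; exact: AZ.
    by rewrite -[(- _) z]/(- (ii R * 1)) mulr1 !cE oppr0.
  rewrite rlinN // in sN1; rewrite rlinN // in sNi; last exact: AZ.
  by apply: cplx_eq; rewrite /complexify !cE /re /im /=; lra.
move=> f Af; rewrite -/(nrm _).
have [u [u1 uf]] := rotate (complexify s f).
have := lin u f 0 Af (ua_zero uaA); rewrite addr0.
have -> : complexify s 0 = 0.
  by rewrite /complexify scaler0 (rlin0 ls) oppr0.
rewrite addr0 uf => /(congr1 (@re R)); rewrite re_real {1}/re /= => <-.
apply: sF; first exact: AZ.
move=> z _; rewrite -[(_ *: _) z]/(u * f z).
apply: le_trans (re_le_nrm _) _; rewrite nrmM u1 mul1r.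
by apply: nrm_le_supnorm => //; exact: ua_continuous Af.
Qed.

(** The inequality at - f gives equality of real parts; i f then gives the imaginary parts. *)
Lemma state_dominated (L : (X -> cplx R) -> cplx R) x : is_state A L ->
  (forall f, A f -> re (L f) <= re (f x)) -> forall f, A f -> L f = f x.
Proof.
move=> sL h f Af.
have E g : A g -> re (L g) = re (g x).
  move=> Ag; apply/eqP; rewrite eq_le h //=.
  have := h _ (ua_opp uaA Ag); rewrite -scaleN1r stateZ // mulN1r.
  by rewrite -[(_ *: _) x]/(-1 * g x) mulN1r !cE lerN2.
apply: cplx_eq; first exact: E.
have := E _ (AZ (ii R) Af); rewrite stateZ // -[(_ *: _) x]/(ii R * f x) !re_iiM.
by move=> /oppr_inj.
Qed.

Lemma complexify_convex s1 s2 (t u : R) x :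
  (forall f, A f -> re (f x) = t * s1 f + u * s2 f) ->
  forall f, A f -> f x = of_real t * complexify s1 f + of_real u * complexify s2 f.
Proof.
move=> h f Af; apply: cplx_eq; rewrite !cE !mul0r ?subr0 ?addr0; first exact: h.
rewrite /complexify /im /= !mulrN -opprD -h; last exact: AZ.
by rewrite -[(_ *: f) x]/(ii R * f x) re_iiM opprK.
Qed.

Lemma ua_separates_re x y : x <> y -> exists2 f, A f & re (f x) < re (f y).
Proof.
move=> xy; have [f Af fne] := ua_separates uaA xy.
have [rlt|rgt|req] := ltgtP (re (f x)) (re (f y)); first by exists f.
  exists (- f); first exact: ua_opp.
  by rewrite -[(- f) x]/(- f x) -[(- f) y]/(- f y) !reN ltrN2.
have [ilt|igt|ieq] := ltgtP (im (f x)) (im (f y)).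
- exists ((- ii R) *: f); first exact: AZ.
  rewrite -[(_ *: f) x]/(- ii R * f x) -[(_ *: f) y]/(- ii R * f y) !cE; lra.
- exists (ii R *: f); first exact: AZ.
  rewrite -[(_ *: f) x]/(ii R * f x) -[(_ *: f) y]/(ii R * f y) !cE; lra.
- by exfalso; apply: fne; exact: cplx_eq.
Qed.

End Choquet.

(** * Absorbing sets, Bishop's criterion and peaking functions *)

Section ChoquetBoundary.
Variables (R : realType) (X : topologicalType) (A : set (X -> cplx R)).
Hypotheses (compactX : compact [set: X]) (uaA : uniform_algebra A).
Implicit Types f g : X -> cplx R.
Implicit Types E F G : set X.

Let AD f g : A f -> A g -> A (f + g). Proof. exact: ua_add. Qed.
Let AZ (c : cplx R) f : A f -> A (c *: f). Proof. exact: ua_scale. Qed.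

Lemma closed_re_ge f (c : R) : A f -> closed [set z | c <= re (f z)].
Proof.
move=> Af; have -> : [set z | c <= re (f z)] = (fun z => re (f z)) @^-1` [set r | c <= r].
  by [].
apply: closed_comp; first by move=> z _; exact: (ua_continuous_re uaA Af).
exact: closed_ge.
Qed.

Lemma closed_re_le f (c : R) : A f -> closed [set z | re (f z) <= c].
Proof.
move=> Af; have -> : [set z | re (f z) <= c] = (fun z => re (f z)) @^-1` [set r | r <= c].
  by [].
apply: closed_comp; first by move=> z _; exact: (ua_continuous_re uaA Af).
exact: closed_le.
Qed.

(** The analogue, for subsets of [X], of a face of the state space. Maximising functions cuts such a
    set down to smaller ones, and the points of a minimal nonempty closed one are Choquet points. *)
Definition absorbing E := forall z, E z ->
  forall (t : R) (L1 L2 : (X -> cplx R) -> cplx R),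
    0 < t < 1 -> is_state A L1 -> is_state A L2 ->
    (forall f, A f -> f z = of_real t * L1 f + of_real (1 - t) * L2 f) ->
    supported A (fun f => re (L1 f)) E /\ supported A (fun f => re (L2 f)) E.

(* For [l] large, [re (g + l f) <= c + e + l m] on all of [E]. *)
Lemma supported_face s E f (m : R) : real_linear_on A s -> supported A s E ->
  closed E -> A f -> (forall z, E z -> re (f z) <= m) -> s f = m ->
  supported A s [set z | E z /\ re (f z) = m].
Proof.
move=> ls sE clE Af fm sf g c Ag gc; apply/ler_addgt0Pr => e e0.
suff [l [l0 hl]] : exists l : R, 0 <= l /\
    forall z, E z -> re (g z) + l * re (f z) <= c + e + l * m.
  have := sE (of_real l *: f + g) (c + e + l * m).
  rewrite (rlinD ls (AZ _ Af) Ag) (rlinZ ls) // sf => h.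
  suff : l * m + s g <= c + e + l * m by lra.
  apply: h => [|z Ez]; first by apply: AD => //; exact: AZ.
  rewrite -[(_ + g) z]/(of_real l * f z + g z) !cE.
  have := hl _ Ez; lra.
pose K := E `&` [set z | c + e <= re (g z)].
have [[k0 Kk0]|nK] := pselect (K !=set0); last first.
  exists 0; split=> // z Ez; rewrite !mul0r !addr0 leNgt; apply/negP => h.
  by apply: nK; exists z; split=> //=; exact: ltW.
have clK : closed K by apply: closedI => //; exact: closed_re_ge.
have [k Kk kmax] := max_attained compactX clK (ex_intro _ k0 Kk0) (ua_continuous_re uaA Af).
have [j Kj jmax] := max_attained compactX clK (ex_intro _ k0 Kk0) (ua_continuous_re uaA Ag).
have km : re (f k) < m.
  rewrite lt_neqAle (fm k) ?andbT; last by case: Kk.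
  apply/eqP => h; have := gc k (conj (proj1 Kk) h); have := proj2 Kk => /=.
  lra.
pose d := m - re (f k); have d0 : 0 < d by rewrite subr_gt0.
pose G := re (g j); have jc : c + e <= G by have := proj2 Kj.
(* On [K], re g <= G and re f <= m - d, so this slope gives re g + l re f <= c + l m. Off [K], re g
   < c + e is enough. *)
exists ((G - c) / d); split.
  by rewrite divr_ge0 ?(ltW d0) //; lra.
have l0 : 0 <= (G - c) / d by rewrite divr_ge0 ?(ltW d0) //; lra.
move=> z Ez; have [h|h] := leP (c + e) (re (g z)).
  have zK : K z by [].
  have := jmax _ zK; have := kmax _ zK => h1 h2.
  have : (G - c) / d * re (f z) <= (G - c) / d * (m - d).
    by apply: ler_wpM2l => //; rewrite /d; lra.
  rewrite mulrBr divfK ?gt_eqF //; rewrite -/G in h2; lra.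
have : (G - c) / d * re (f z) <= (G - c) / d * m.
  by apply: ler_wpM2l => //; exact: fm.
lra.
Qed.

(** The maximum m is a convex combination of two values that are at most m, so both equal m and
    [supported_face] applies. *)
Lemma absorbing_face E f (m : R) : absorbing E -> closed E -> A f ->
  (forall z, E z -> re (f z) <= m) ->
  absorbing [set z | E z /\ re (f z) = m].
Proof.
move=> aE clE Af fm z [Ez fz] t L1 L2 t01 s1 s2 dec.
have [p1 p2] := aE z Ez t L1 L2 t01 s1 s2 dec.
have m1 := p1 _ _ Af fm; have m2 := p2 _ _ Af fm.
have E1 : m = t * re (L1 f) + (1 - t) * re (L2 f).
  by rewrite -fz (dec _ Af) !cE !mul0r !subr0.
have /andP[t0 t1] := t01.
have h1 : t * re (L1 f) <= t * m by rewrite ler_wpM2l // ltW.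
have h2 : (1 - t) * re (L2 f) <= (1 - t) * m.
  by rewrite ler_wpM2l // subr_ge0 ltW.
have e1 : t * re (L1 f) = t * m by lra.
have e2 : (1 - t) * re (L2 f) = (1 - t) * m by lra.
have t'0 : 1 - t != 0 by rewrite subr_eq0 eq_sym lt_eqF.
split; apply: supported_face => //; try exact: state_real_linear.
  by apply: (mulfI (lt0r_neq0 t0)).
exact: (mulfI t'0).
Qed.

(** On a minimal nonempty closed absorbing subset of the set of maximum points, every re g is
    constant, since maximising it cannot give a smaller set. States living there are then dominated
    by the evaluation at any of its points. *)
Lemma choquet_max f : X -> A f ->
  exists2 x, choquet A x & forall z, re (f z) <= re (f x).
Proof.
move=> x0 Af.
have [|x1 _ x1max] := max_attained compactX closedT _ (ua_continuous_re uaA Af).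
  by exists x0.
pose E0 := [set z | [set: X] z /\ re (f z) = re (f x1)].
have aT : absorbing setT.
  by move=> z _ t L1 L2 _ s1 s2 _; split; exact: state_supported.
have face_closed E g (m : R) : closed E -> A g -> closed [set z | E z /\ re (g z) = m].
  move=> clE Ag.
  have -> : [set z | E z /\ re (g z) = m] =
      E `&` ([set z | re (g z) <= m] `&` [set z | m <= re (g z)]).
    apply/seteqP; split=> z /=; first by move=> [Ez ->]; rewrite lexx.
    by move=> [Ez [h1 h2]]; split=> //; apply: le_anti; rewrite h1.
  by apply: closedI => //; apply: closedI; [exact: closed_re_le|exact: closed_re_ge].
pose P E := E !=set0 /\ absorbing E.
have P0 : P E0.
  split; first by exists x1.
  by apply: absorbing_face => // z _; exact: x1max.
have chainP (C : set (set X)) : C !=set0 -> (forall F, C F -> closed F /\ P F) ->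
     total_on C subset -> P (\bigcap_(F in C) F).
  move=> C0 CP totC.
  have clC F : C F -> closed F by move=> /CP[].
  split.
    apply: contrapT => nC.
    have [||F CF F0] := chain_capture compactX (U := set0) C0 clC totC.
    - exact: open0.
    - by move=> z hz; apply: nC; exists z.
    - by have [_ [[z /F0]]] := CP _ CF.
  move=> z Cz t L1 L2 t01 s1 s2 dec; split; apply: chain_supported => // F CF;
    have [_ [_ aF]] := CP _ CF; by have [] := aF z (Cz _ CF) t L1 L2 t01 s1 s2 dec.
have cl0 : closed E0 by apply: face_closed => //; exact: closedT.
have [E [EE0 clE [[x Ex] aE] Emin]] := minimal_closed cl0 P0 chainP.
exists x; last by move=> z; have [_ ->] := EE0 _ Ex; exact: x1max.
have const g : A g -> forall z, E z -> re (g z) <= re (g x).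
  move=> Ag; have [|y Ey ymax] := max_attained compactX clE _ (ua_continuous_re uaA Ag).
    by exists x.
  have sub : E `<=` [set z | E z /\ re (g z) = re (g y)].
    apply: Emin; [by move=> z []|exact: face_closed|].
    by split; [exists y|exact: absorbing_face].
  by move=> z Ez; have [_ ->] := sub _ Ez; have [_ ->] := sub _ Ex.
move=> t L1 L2 t01 s1 s2 dec f' Af'.
have [p1 p2] := aE x Ex t L1 L2 t01 s1 s2 dec.
split; apply: (state_dominated uaA) => // g Ag.
  by apply: p1 => // z; exact: const.
by apply: p2 => // z; exact: const.
Qed.

Lemma choquet_nrm_max f : X -> A f ->
  exists2 x, choquet A x & nrm (f x) = supnorm f.
Proof.
move=> x0 Af; have cf := ua_continuous uaA Af.
have [y fy] := supnorm_attained compactX cf x0.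
have [u [u1 uf]] := rotate (f y).
have [x chx xmax] := choquet_max x0 (AZ u Af).
exists x => //; apply/eqP; rewrite eq_le nrm_le_supnorm //= -fy.
have := xmax y; rewrite -[(u *: f) y]/(u * f y) -[(u *: f) x]/(u * f x) uf re_real.
by move=> /le_trans; apply; apply: le_trans (re_le_nrm _) _; rewrite nrmM u1 mul1r.
Qed.

(** The support function of [F]: for nonempty closed [F], a functional is supported by [F] exactly
    when it is at most [remax F] on [A]. *)
Definition remax F f : R := sup [set re (f z) | z in F].

Lemma remax_ub F f z : A f -> closed F -> F z -> re (f z) <= remax F f.
Proof.
move=> Af clF Fz; apply: ub_le_sup; last by exists z.
have [|y Fy ymax] := max_attained compactX clF _ (ua_continuous_re uaA Af).
  by exists z.
by exists (re (f y)) => _ [x Fx <-]; exact: ymax.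
Qed.

Lemma remax_le F f c : F !=set0 -> (forall z, F z -> re (f z) <= c) -> remax F f <= c.
Proof.
move=> [z Fz] h; apply: ge_sup; first by exists (re (f z)), z.
by move=> _ [x Fx <-]; exact: h.
Qed.

Lemma remax_sublinear F : closed F -> F !=set0 -> sublinear_on A (remax F).
Proof.
move=> clF F0; split=> [f g Af Ag|t f t0 Af]; apply: remax_le => // z Fz.
  by rewrite -[(f + g) z]/(f z + g z) reD lerD // remax_ub.
rewrite -[(_ *: f) z]/(of_real t * f z) !cE mul0r subr0.
by rewrite ler_wpM2l // remax_ub.
Qed.

(* The sandwich theorem writes the evaluation at [x] as a convex combination of
   a state supported by [E] and one supported by [F]; by extremality both are the
   evaluation itself. *)
Lemma choquet_convex x (t : R) E F : choquet A x -> closed E -> closed F ->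
  E !=set0 -> F !=set0 -> 0 < t < 1 ->
  (forall f, A f -> re (f x) <= (1 - t) * remax E f + t * remax F f) ->
  supported A (pt_re x) E /\ supported A (pt_re x) F.
Proof.
move=> chx clE clF E0 F0 t01 h; have /andP[t0 t1] := t01.
have t'0 : 0 < 1 - t by rewrite subr_gt0.
have sE := remax_sublinear clE E0; have sF := remax_sublinear clF F0.
have tn0 : t != 0 by rewrite gt_eqF.
have t'n0 : 1 - t != 0 by rewrite gt_eqF.
have lx := pt_re_linear A x.
have [||f Af|s [ls hs]] := sandwich AD AZ (a := fun f => (1 - t) * remax E f)
    (b := fun f => re (f x) - t * remax F f) (ua_zero uaA).
- split=> [f g Af Ag|r f r0 Af].
    rewrite -mulrDr; apply: ler_wpM2l; [exact: ltW|exact: sublinD sE _ _ Af Ag].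
  by rewrite mulrCA; apply: ler_wpM2l; [exact: ltW|exact: sublinZ sE _ _ r0 Af].
- split=> [f g Af Ag|r f r0 Af].
    have := rlinD lx Af Ag; rewrite /pt_re => ->.
    have : t * remax F (f + g) <= t * (remax F f + remax F g).
      by apply: ler_wpM2l; [exact: ltW|exact: sublinD sF _ _ Af Ag].
    lra.
  have := rlinZ lx r Af; rewrite /pt_re => ->.
  have : t * remax F (of_real r *: f) <= t * (r * remax F f).
    by apply: ler_wpM2l; [exact: ltW|exact: sublinZ sF _ _ r0 Af].
  lra.
- have := h _ Af; lra.
pose s1 f := (1 - t)^-1 * s f.
pose s2 f := t^-1 * (re (f x) - s f).
have l1 : real_linear_on A s1.
  split=> [f g Af Ag|r f Af]; rewrite /s1; first by rewrite (rlinD ls) // mulrDr.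
  by rewrite (rlinZ ls) // mulrCA.
have l2 : real_linear_on A s2.
  split=> [f g Af Ag|r f Af]; rewrite /s2.
    by rewrite (rlinD ls) //; have := rlinD lx Af Ag; rewrite /pt_re => ->; ring.
  by rewrite (rlinZ ls) //; have := rlinZ lx r Af; rewrite /pt_re => ->; ring.
have p1 : supported A s1 E.
  move=> f c Af fc; rewrite /s1 ler_pdivrMl //.
  have /andP[_] := hs _ Af; move=> /le_trans; apply.
  by apply: ler_wpM2l; [exact: ltW|exact: remax_le].
have p2 : supported A s2 F.
  move=> f c Af fc; rewrite /s2 ler_pdivrMl //.
  have : t * remax F f <= t * c by apply: ler_wpM2l; [exact: ltW|exact: remax_le].
  have /andP[] := hs _ Af; lra.
have S1 := complexify_state compactX uaA l1 p1.
have S2 := complexify_state compactX uaA l2 p2.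
have dec f : A f -> f x = of_real t * complexify s2 f + of_real (1 - t) * complexify s1 f.
  apply: (complexify_convex uaA) => g Ag.
  by rewrite /s1 /s2 !mulrA !divff // !mul1r subrK.
have eq12 := chx t _ _ t01 S2 S1 dec.
split=> f c Af fc; have [e2 e1] := eq12 _ Af; rewrite /pt_re.
  by rewrite -e1; exact: p1.
by rewrite -e2; exact: p2.
Qed.

(** The evaluation is dominated by the larger of two support functions; a weight [t] is found for
    which it is dominated by their convex combination. If 0 < t < 1, [choquet_convex] applies; t = 0
    and t = 1 are direct. *)
Lemma choquet_split x E F : choquet A x -> closed E -> closed F ->
  supported A (pt_re x) (E `|` F) ->
  supported A (pt_re x) E \/ supported A (pt_re x) F.
Proof.
move=> chx clE clF sEF.
have [E0|nE] := pselect (E !=set0); last first.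
  right; apply: supported_sub sEF => z [Ez|//].
  by exfalso; apply: nE; exists z.
have [F0|nF] := pselect (F !=set0); last first.
  left; apply: supported_sub sEF => z [//|Fz].
  by exfalso; apply: nF; exists z.
set p1 := remax E; set p2 := remax F.
have s1 := remax_sublinear clE E0; have s2 := remax_sublinear clF F0.
have hmax f (c : R) : A f -> p1 f <= c -> p2 f <= c -> re (f x) <= c.
  move=> Af h1 h2; apply: sEF => // z [Ez|Fz].
    by apply: le_trans h1; exact: remax_ub.
  by apply: le_trans h2; exact: remax_ub.
(* Functions with p1 g < p2 g bound the weight of [F] from below by these quotients, those with p2 f
   < p1 f bound it from above; [key] makes the bounds compatible. *)
pose S := [set (re (g x) - p1 g) / (p2 g - p1 g) | g in [set g | A g /\ p1 g < p2 g]].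
have key f g : A f -> A g -> p2 f < p1 f -> p1 g < p2 g ->
    (re (g x) - p1 g) / (p2 g - p1 g) <= (p1 f - re (f x)) / (p1 f - p2 f).
  move=> Af Ag df dg.
  have a0 : 0 < p2 g - p1 g by rewrite subr_gt0.
  have b0 : 0 < p1 f - p2 f by rewrite subr_gt0.
  rewrite ler_pdivrMr // mulrAC ler_pdivlMr //.
  set a := p2 g - p1 g in a0 *; set b := p1 f - p2 f in b0 *.
  (* These coefficients make the bounds for [p1 u] and [p2 u] equal, so that [hmax] compares re (u
     x) with a single number. *)
  pose u := of_real b *: g + of_real a *: f.
  have Au : A u by apply: AD; exact: AZ.
  have u1 : p1 u <= b * p1 g + a * p1 f.
    apply: le_trans (sublinD s1 (AZ _ Ag) (AZ _ Af)) _.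
    by rewrite lerD // (sublinZ s1) // ltW.
  have u2 : p2 u <= b * p2 g + a * p2 f.
    apply: le_trans (sublinD s2 (AZ _ Ag) (AZ _ Af)) _.
    by rewrite lerD // (sublinZ s2) // ltW.
  have := hmax u _ Au u1; rewrite -[u x]/(of_real b * g x + of_real a * f x) !cE.
  have -> : b * p1 g + a * p1 f = b * p2 g + a * p2 f by rewrite /a /b; ring.
  move=> /(_ u2); have : b * p2 g + a * p2 f = b * p1 g + a * p1 f by rewrite /a /b; ring.
  lra.
pose S0 := [set 0] `|` S.
have S0ub (c : R) : 0 <= c -> (forall g, A g -> p1 g < p2 g ->
    (re (g x) - p1 g) / (p2 g - p1 g) <= c) -> ubound S0 c.
  by move=> c0 h _ [->//|[g [Ag dg] <-]]; exact: h.
have S01 : ubound S0 1.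
  apply: S0ub => // g Ag dg; rewrite ler_pdivrMr ?subr_gt0 // mul1r lerD2r.
  by apply: hmax => //; exact: ltW.
have hS0 : has_ubound S0 by exists 1.
pose t := sup S0.
have t0 : 0 <= t by apply: ub_le_sup => //; left.
have t1 : t <= 1 by apply: ge_sup => //; exists 0; left.
have ht f : A f -> re (f x) <= (1 - t) * p1 f + t * p2 f.
  move=> Af; have [d|d|d] := ltgtP (p2 f) (p1 f).
  - suff : t * (p1 f - p2 f) <= p1 f - re (f x) by lra.
    rewrite -ler_pdivlMr ?subr_gt0 //; apply: ge_sup; first by exists 0; left.
    apply: S0ub => [|g Ag dg]; last exact: key.
    rewrite divr_ge0 ?subr_ge0 ?(ltW d) //; apply: hmax => //; exact: ltW.
  - suff : re (f x) - p1 f <= t * (p2 f - p1 f) by lra.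
    rewrite -ler_pdivrMr ?subr_gt0 //; apply: ub_le_sup => //.
    by right; exists f.
  - have := hmax f (p1 f) Af (lexx _); rewrite -d => /(_ (lexx _)); lra.
have [tz|tn0] := eqVneq t 0.
  left=> f c Af fc; apply: le_trans (ht f Af) _.
  by rewrite tz subr0 mul1r mul0r addr0; exact: remax_le.
have [to|tn1] := eqVneq t 1.
  right=> f c Af fc; apply: le_trans (ht f Af) _.
  by rewrite to subrr mul1r mul0r add0r; exact: remax_le.
left; apply: (proj1 (@choquet_convex x t E F _ _ _ _ _ _ _)) => //.
by rewrite !lt_neqAle t0 t1 tn1 eq_sym tn0.
Qed.

(** In a minimal closed supporting set, a point y other than x would be separated from x by some re
    f. Cutting at the mean value, [choquet_split] yields a supporting half: the upper one misses y,
    against minimality, and the lower one would give re (f x) less than itself. *)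
Lemma choquet_supported x F : choquet A x -> closed F ->
  supported A (pt_re x) F -> F x.
Proof.
move=> chx clF sF.
have chainP (C : set (set X)) : C !=set0 ->
    (forall G, C G -> closed G /\ supported A (pt_re x) G) ->
    total_on C subset -> supported A (pt_re x) (\bigcap_(G in C) G).
  by move=> C0 CP totC; apply: chain_supported => // G /CP[].
have [G [GF clG sG Gmin]] := minimal_closed clF sF chainP.
have Gx : G `<=` [set x].
  move=> y Gy; apply: contrapT => /= yx.
  have [f Af fxy] := ua_separates_re uaA yx.
  pose m := (re (f y) + re (f x)) / 2.
  have ym : re (f y) < m by rewrite /m; lra.
  have mx : m < re (f x) by rewrite /m; lra.
  pose G1 := G `&` [set z | re (f z) <= m].
  pose G2 := G `&` [set z | m <= re (f z)].
  have cl1 : closed G1 by apply: closedI => //; exact: closed_re_le.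
  have cl2 : closed G2 by apply: closedI => //; exact: closed_re_ge.
  have [|h|h] := choquet_split chx cl1 cl2.
  - apply: supported_sub sG => z Gz.
    by have [h|h] := leP (re (f z)) m; [left|right; split=> //; exact: ltW].
  - have : re (f x) <= m by apply: h => // z [].
    lra.
  - have [_ /=] := Gmin G2 (fun z h => proj1 h) cl2 h y Gy; lra.
have [[z Gz]|nG] := pselect (G !=set0).
  by have <- := Gx _ Gz; exact: GF.
have : pt_re x (1 : X -> cplx R) <= 0.
  apply: sG => [|z Gz]; first exact: ua_one.
  by exfalso; apply: nG; exists z.
by rewrite /pt_re re1 ler10.
Qed.

(** Bishop's criterion. Let - t be the supremum of re (h x) over h with real part at most 0, and at
    most - 1 on [F]. If t = 0, a large multiple of a nearly optimal h works; if t > 0, the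
    evaluation is supported by [F]. *)
Lemma choquet_bishop x F (M e : R) : choquet A x -> closed F -> ~ F x ->
  0 < M -> 0 < e ->
  exists h, [/\ A h, forall z, re (h z) <= 0, forall z, F z -> re (h z) <= - M
                & - e <= re (h x)].
Proof.
move=> chx clF nFx M0 e0.
have [F0|nF] := pselect (F !=set0); last first.
  exists 0; split=> [|z|z Fz|]; first exact: ua_zero.
  - exact: lexx.
  - by exfalso; apply: nF; exists z.
  - by rewrite oppr_le0 ltW.
pose H h := [/\ A h, forall z, re (h z) <= 0 & forall z, F z -> re (h z) <= -1].
pose S := [set re (h x) | h in H].
have S0 : S !=set0.
  exists (-1), (cst (of_real (-1))) => //; split=> [||//].
    exact: ua_cst.
  by move=> z; rewrite re_real; lra.
have Sub : has_ubound S by exists 0 => _ [h [_ h0 _] <-]; exact: h0.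
pose t := - sup S.
have t0 : 0 <= t by rewrite oppr_ge0; apply: ge_sup => // _ [h [_ h0 _] <-]; exact: h0.
have t1 : t <= 1.
  rewrite lerNl; apply: ub_le_sup => //; exists (cst (of_real (-1))) => //.
  by split=> [||//]; [exact: ua_cst|move=> z; rewrite re_real; lra].
have clT := @closedT X.
have T0 : [set: X] !=set0 by exists x.
have ht f : A f -> re (f x) <= (1 - t) * remax setT f + t * remax F f.
  move=> Af; set P := remax setT f; set Q := remax F f.
  have QP : Q <= P by apply: remax_le => // z _; exact: remax_ub.
  have [d|d] := ltP Q P; last first.
    have -> : Q = P by apply: le_anti; rewrite QP.
    by rewrite -mulrDl subrK mul1r; exact: remax_ub.
  have d0 : 0 < P - Q by rewrite subr_gt0.
  (* This affine rescaling sends the maxima P over [X] and Q over [F] to 0 and - 1. *)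
  pose h := of_real (P - Q)^-1 *: (f - cst (of_real P)).
  have hz z : re (h z) = (P - Q)^-1 * (re (f z) - P).
    by rewrite -[h z]/(of_real (P - Q)^-1 * (f z - of_real P)) !cE mul0r subr0.
  have Hh : H h.
    split.
    - by apply: AZ; apply: ua_sub => //; exact: ua_cst.
    - move=> z; rewrite hz ler_pdivrMl // mulr0 subr_le0; exact: remax_ub.
    - move=> z Fz; rewrite hz ler_pdivrMl // mulrN1 opprB lerD2r; exact: remax_ub.
  have : re (h x) <= - t by rewrite opprK; apply: ub_le_sup => //; exists h.
  by rewrite hz ler_pdivrMl //; lra.
have [tz|tn0] := eqVneq t 0.
  have eM : 0 < e / M by rewrite divr_gt0.
  have [_ [h [Ah h0 hF] <-]] := sup_adherent eM (conj S0 Sub).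
  rewrite -[sup S]opprK -/t tz oppr0 sub0r => hx.
  have hz z : re ((of_real M *: h) z) = M * re (h z).
    by rewrite -[(_ *: _) z]/(of_real M * h z) !cE mul0r subr0.
  exists (of_real M *: h); split.
  - exact: AZ.
  - by move=> z; rewrite hz mulr_ge0_le0 // ltW.
  - move=> z Fz; rewrite hz -[leRHS]mulrN1.
    by apply: ler_wpM2l; [exact: ltW|exact: hF].
  - rewrite hz -ler_pdivrMl // mulrN mulrC ltW //.
exfalso; apply: nFx; apply: choquet_supported => //.
have [to|tn1] := eqVneq t 1.
  move=> f c Af fc; apply: le_trans (ht f Af) _.
  by rewrite to subrr mul1r mul0r add0r; exact: remax_le.
apply: (proj2 (@choquet_convex x t setT F _ _ _ _ _ _ _)) => //.
by rewrite !lt_neqAle t0 t1 tn1 eq_sym tn0.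
Qed.

(* [g = 1 / (1 - h)] takes its values in the disc of diameter [0, 1]. *)
Lemma choquet_peak x F (d : R) : choquet A x -> closed F -> ~ F x -> 0 < d < 1 ->
  exists g, [/\ ua_inv A g, forall z, nrm (g z - of_real 2^-1) <= 2^-1,
    forall z, F z -> nrm (g z) <= d &
    exists2 r : R, 1 - d <= r <= 1 & g x = of_real r].
Proof.
move=> chx clF nFx /andP[d0 d1].
have dV : 0 < d^-1 by rewrite invr_gt0.
(* With these constants |g| <= 1 / (1 + 1 / d) <= d on [F]. Once the imaginary part of h at x is
   removed, g x is real and at least 1 / (1 + d) >= 1 - d. *)
have [h [Ah h0 hF hx]] := choquet_bishop chx clF nFx dV d0.
pose k := h - cst (of_real (im (h x)) * ii R).
have rek z : re (k z) = re (h z).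
  by rewrite -[k z]/(h z - of_real (im (h x)) * ii R) !cE; ring.
have imk : im (k x) = 0.
  by rewrite -[k x]/(h x - of_real (im (h x)) * ii R) !cE; ring.
have Ak : A k by apply: ua_sub => //; exact: ua_cst.
have ki : ua_inv A (1 - k) by apply: ua_inv_one_sub => // z; rewrite rek.
exists (fun z => ((1 - k) z)^-1).
have E z : (1 - k) z = 1 - k z by [].
have nz z : 1 - k z != 0 by exact: (ua_inv_neq0 z ki).
have re1k z : re (1 - k z) = 1 - re (h z) by rewrite reB re1 rek.
split.
- exact: ua_inv_inv.
- move=> z; rewrite E; set w := 1 - k z.
  have w1 : 1 <= re w by rewrite re1k; have := h0 z; lra.
  have wn : w != 0 := nz z; clearbody w.
  have tn : of_real 2 != 0 :> cplx R by rewrite -nrm_gt0 nrm_real normr_gt0.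
  (* In this form the bound 1/2 says |2 - w| <= |w|, that is re w >= 1. *)
  have -> : w^-1 - of_real 2^-1 = (of_real 2 - w) / (of_real 2 * w).
    have -> : of_real 2^-1 = (of_real 2)^-1 :> cplx R.
      by apply: (mulfI tn); rewrite divff // -of_realM divff.
    by field; rewrite ?wn ?tn.
  rewrite nrm_div nrmM nrm_real ger0_norm // ler_pdivrMr; last first.
    by rewrite mulr_gt0 // nrm_gt0.
  rewrite mulrA mulVf // mul1r -ler_sqr ?nnegrE ?nrm_ge0 // !nrm_sqr !cE.
  move: (re w) (im w) w1 => a b a1; nra.
- move=> z Fz; rewrite E nrmV -[leRHS]invrK lef_pV2 ?posrE ?nrm_gt0 //.
  apply: le_trans (re_le_nrm _); rewrite re1k.
  have := hF _ Fz; lra.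
exists (1 - re (h x))^-1.
  have hx0 := h0 x; have p : 0 < 1 - re (h x) by lra.
  rewrite invf_le1 //; apply/andP; split; last by lra.
  rewrite -[leLHS]mulr1 -[leRHS]mul1r ler_pdivlMr // mulr1; nra.
rewrite E; have -> : 1 - k x = of_real (1 - re (h x)).
  apply: cplx_eq; first by rewrite re1k re_real.
  by rewrite imB imk im1 subr0 im_real.
have p : 1 - re (h x) != 0 by apply/eqP; have := h0 x; lra.
apply: (mulfI (_ : of_real (1 - re (h x)) != 0)).
  by rewrite -nrm_gt0 nrm_real normr_gt0.
rewrite divff -?of_realM ?divff //.
by rewrite -nrm_gt0 nrm_real normr_gt0.
Qed.

End ChoquetBoundary.

(** * Norm-preserving bijections between groups of invertible elements *)

(** The inverse [S'] is carried along so that, by [preserver_sym], each result also holds in the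
    other direction. *)
Record preserver (R : realType) (X Y : topologicalType)
    (A : set (X -> cplx R)) (B : set (Y -> cplx R))
    (S : (X -> cplx R) -> (Y -> cplx R)) (S' : (Y -> cplx R) -> (X -> cplx R))
    : Prop := Preserver {
  pres_fun : forall f, ua_inv A f -> ua_inv B (S f) ;
  pres_fun' : forall F, ua_inv B F -> ua_inv A (S' F) ;
  presK : forall f, ua_inv A f -> S' (S f) = f ;
  presK' : forall F, ua_inv B F -> S (S' F) = F ;
  pres_norm : forall f g, ua_inv A f -> ua_inv A g ->
    supnorm (S f * S g - 1) = supnorm (f * g - 1) ;
  pres_one : S 1 = 1 }.

Lemma preserver_sym (R : realType) (X Y : topologicalType)
    (A : set (X -> cplx R)) (B : set (Y -> cplx R)) S S' :
  uniform_algebra A -> preserver A B S S' -> preserver B A S' S.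
Proof.
move=> uaA [h1 h2 h3 h4 h5 h6]; split=> //.
  by move=> F G BF BG; rewrite -h5 ?h4 //; exact: h2.
by rewrite -h6 h3 //; exact: ua_inv_one.
Qed.

Lemma linear_bound_le (R : realType) (b c : R) :
  (forall M : R, 0 < M -> M * b <= M * c + 1) -> b <= c.
Proof.
move=> h; apply/ler_addgt0Pr => e e0.
have := h e^-1; rewrite invr_gt0 => /(_ e0).
by rewrite ler_pdivrMl // mulrDr mulrA divff ?gt_eqF // mul1r mulr1.
Qed.

(** By (u + v)^2 <= 2 u^2 + 2 v^2 the square of the right-hand side is at most 2 + 2 M re a + M^2
    |a|^2, and that of the left-hand side is 1 + 2 M re b + M^2 |b|^2. The quadratic terms cancel,
    and M is arbitrarily large. *)
Lemma re_le_of_disc (R : realType) (a b : cplx R) : nrm a = nrm b ->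
  (forall M : R, 0 < M -> nrm (of_real M * b + 1) <=
     nrm (1 + of_real (M / 2) * a) + M / 2 * nrm a) -> re b <= re a.
Proof.
move=> ab h; apply: linear_bound_le => M M0.
have h1 := h M M0.
have n0 := nrm_ge0 (of_real M * b + 1).
have u0 := nrm_ge0 (1 + of_real (M / 2) * a).
have e1 := nrm_sqr (of_real M * b + 1).
have e2 := nrm_sqr (1 + of_real (M / 2) * a).
have ea := nrm_sqr a; have eb := nrm_sqr b; rewrite -ab in eb.
move: e1 e2; rewrite !cE !mul0r !subr0 !addr0 !add0r => e1 e2.
set v := nrm (of_real M * b + 1) in h1 n0 e1.
set u := nrm (1 + of_real (M / 2) * a) in h1 u0 e2.
have v2 : v ^+ 2 <= (u + M / 2 * nrm a) ^+ 2.
  by rewrite lerXn2r // nnegrE ?addr_ge0 // mulr_ge0 ?nrm_ge0 // divr_ge0 // ltW.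
have := sqr_ge0 (u - M / 2 * nrm a).
have E1 : v ^+ 2 = 1 + 2 * (M * re b) + M ^+ 2 * nrm a ^+ 2.
  by rewrite e1 eb; ring.
have E2 : u ^+ 2 = 1 + M * re a + M ^+ 2 / 4 * nrm a ^+ 2.
  by rewrite e2 ea; field.
move: v2; rewrite E1 sqrrB sqrrD E2.
have -> : (M / 2 * nrm a) ^+ 2 = M ^+ 2 / 4 * nrm a ^+ 2 by field.
lra.
Qed.

Section Preserver.
Variables (R : realType) (X Y : topologicalType).
Variables (A : set (X -> cplx R)) (B : set (Y -> cplx R)).
Hypotheses (compactX : compact [set: X]) (compactY : compact [set: Y]).
Hypotheses (uaA : uniform_algebra A) (uaB : uniform_algebra B).
Variables (S : (X -> cplx R) -> (Y -> cplx R)) (S' : (Y -> cplx R) -> (X -> cplx R)).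
Hypothesis pS : preserver A B S S'.
Implicit Types (f g k l : X -> cplx R) (F G : Y -> cplx R).

Let ctsA f : A f -> continuous f := ua_continuous uaA (f := f).
Let ctsB F : B F -> continuous F := ua_continuous uaB (f := F).

(** On an empty [X] all norms are 0, whereas the constant 2 on [Y] is at distance 1 from 1. *)
Lemma preserver_inhabited : Y -> inhabited X.
Proof.
move=> y; apply: contrapT => nX.
have two0 : of_real 2 != 0 :> cplx R by rewrite -nrm_gt0 nrm_real normr_gt0.
have two : ua_inv B (cst (of_real 2)) by exact: ua_inv_cst.
have := pres_norm pS (pres_fun' pS two) (ua_inv_one uaA).
rewrite (presK' pS) // (pres_one pS) => h.
have cF : continuous (cst (of_real 2) * (1 : Y -> cplx R) - 1).
  apply: ctsB; apply: ua_sub => //; last exact: ua_one.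
  by apply: ua_mul => //; [exact: ua_cst|exact: ua_one].
have := nrm_le_supnorm compactY y cF.
rewrite h -[(_ - 1) y]/(of_real 2 * 1 - 1) mulr1.
have -> : of_real 2 - 1 = 1 :> cplx R by apply: cplx_eq; rewrite !cE; lra.
rewrite nrm1 => h1.
suff : supnorm (S' (cst (of_real 2)) * 1 - 1) <= 0 by lra.
by apply: supnorm_le => // x; exfalso; apply: nX.
Qed.

Lemma preserver_inv f : ua_inv A f ->
  S (fun x => (f x)^-1) = fun y => (S f y)^-1.
Proof.
move=> Af; have Af' := ua_inv_inv Af.
have := pres_norm pS Af Af'.
have -> : f * (fun x => (f x)^-1) - 1 = 0.
  apply/funext => x; rewrite -[LHS]/(f x / f x - 1) divff ?subrr //.
  exact: ua_inv_neq0 Af.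
rewrite (supnorm0 _ compactX) => /supnorm0_eq0 S0.
apply/funext => y.
have c : continuous (S f * S (fun x => (f x)^-1) - 1).
  apply: ctsB; apply: ua_sub => //; last exact: ua_one.
  by apply: ua_mul => //; apply: ua_inv_sub; exact: (pres_fun pS).
have /(congr1 (@^~ y))/eqP := S0 compactY c.
rewrite -[_ == _]/(S f y * S (fun x => (f x)^-1) y - 1 == 0).
rewrite subr_eq0 => /eqP e.
have n0 := ua_inv_neq0 y (pres_fun pS Af).
by apply: (mulfI n0); rewrite e divff.
Qed.

(** Triangle inequality on both sides of the norm equality. The additive 2 becomes negligible for
    functions scaled by a large factor. *)
Lemma preserver_coarse f g : ua_inv A f -> ua_inv A g ->
  supnorm (f * g) <= supnorm (S f * S g) + 2.
Proof.
move=> Af Ag.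
have SA : B (S f * S g) by apply: ua_mul => //; apply: ua_inv_sub; exact: (pres_fun pS).
have fgA : A (f * g) by apply: ua_mul => //; exact: ua_inv_sub.
have h1 : supnorm (f * g) <= supnorm (f * g - 1) + 1.
  apply: supnorm_le => [|x].
    by rewrite addr_ge0 // supnorm_ge0 //; apply: ctsA; apply: ua_sub => //; exact: ua_one.
  have -> : (f * g) x = (f * g - 1) x + 1 by rewrite -[(f * g - 1) x]/((f * g) x - 1) subrK.
  apply: le_trans (nrmD _ _) _; rewrite nrm1 lerD2r nrm_le_supnorm //.
  by apply: ctsA; apply: ua_sub => //; exact: ua_one.
have h2 : supnorm (S f * S g - 1) <= supnorm (S f * S g) + 1.
  apply: supnorm_le => [|y].
    by rewrite addr_ge0 // supnorm_ge0 //; apply: ctsB.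
  rewrite -[(S f * S g - 1) y]/((S f * S g) y - 1).
  apply: le_trans (nrmB _ _) _; rewrite nrm1 lerD2r nrm_le_supnorm //.
  exact: ctsB.
rewrite (pres_norm pS) // in h2; lra.
Qed.

End Preserver.

(** * A point of [X] with the same moduli *)

Section ModulusPoint.
Variables (R : realType) (X Y : topologicalType).
Variables (A : set (X -> cplx R)) (B : set (Y -> cplx R)).
Hypotheses (compactX : compact [set: X]) (compactY : compact [set: Y]).
Hypotheses (uaA : uniform_algebra A) (uaB : uniform_algebra B).
Variables (S : (X -> cplx R) -> (Y -> cplx R)) (S' : (Y -> cplx R) -> (X -> cplx R)).
Hypothesis pS : preserver A B S S'.
Implicit Types (f g k l : X -> cplx R) (F G : Y -> cplx R).

Let ctsA f : A f -> continuous f := ua_continuous uaA (f := f).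
Let ctsB F : B F -> continuous F := ua_continuous uaB (f := F).
Let pS' : preserver B A S' S := preserver_sym uaA pS.

(* The almost-maximum points of the preimages of high peaks concentrated on [V]. *)
Let near_max (V : set Y) (d : R) : set X :=
  [set x | exists d' G, [/\ 0 < d' <= d, ua_inv B G, forall z, nrm (G z) <= 1,
     forall z, ~ V z -> nrm (G z) <= d' &
     1 - 3 * d' <= d' * nrm (S' (of_real d'^-1 *: G) x)]].

Let scale_inv (c : cplx R) G : c != 0 -> ua_inv B G -> ua_inv B (c *: G).
Proof.
move=> c0 BG; have -> : c *: G = cst c * G by [].
by apply: ua_inv_mul => //; exact: ua_inv_cst.
Qed.

Let real_neq0 (t : R) : 0 < t -> of_real t != 0 :> cplx R.
Proof. by move=> t0; rewrite -nrm_gt0 nrm_real normr_gt0 gt_eqF. Qed.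

Lemma peak_le1 (w : cplx R) : nrm (w - of_real 2^-1) <= 2^-1 -> nrm w <= 1.
Proof.
move=> h; have := nrmD (w - of_real 2^-1) (of_real 2^-1).
rewrite subrK nrm_real ger0_norm // => h1; lra.
Qed.

Let near_max_neq0 y V d : choquet B y -> open V -> V y -> 0 < d < 1 ->
  near_max V d !=set0.
Proof.
move=> chy oV Vy d01; have /andP[d0 d1] := d01.
have [G [BG Gd GF [r /andP[r1 _] Gr]]] :=
  choquet_peak compactY uaB chy (open_closedC oV) (fun h => h Vy) d01.
have dn0 : of_real d^-1 != 0 :> cplx R by apply: real_neq0; rewrite invr_gt0.
have BdG := scale_inv dn0 BG.
have Ag := pres_fun' pS BdG.
have [x0] := preserver_inhabited compactY uaA uaB pS y.
have [x gx] := supnorm_attained compactX (ctsA (ua_inv_sub Ag)) x0.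
exists x, d, G; split=> //; first by rewrite d0 lexx.
  by move=> z; exact: peak_le1.
rewrite gx; have := preserver_coarse compactY compactX uaB uaA pS' BdG (ua_inv_one uaB).
rewrite (pres_one pS') !mulr1 => h.
have h1 : d^-1 * (1 - d) <= supnorm (of_real d^-1 *: G).
  apply: le_trans (nrm_le_supnorm compactY y (ctsB (ua_inv_sub BdG))).
  rewrite -[(_ *: G) y]/(of_real d^-1 * G y) Gr nrmM !nrm_real.
  rewrite ger0_norm ?invr_ge0 ?(ltW d0) // ler_pM2l ?invr_gt0 //.
  exact: le_trans (ler_norm _).
(* Multiplied by d, this is the threshold 1 - 3 d of [near_max]. *)
have h2 : d^-1 * (1 - d) <= supnorm (S' (of_real d^-1 *: G)) + 2 := le_trans h1 h.
rewrite ler_pdivrMl // in h2; lra.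
Qed.

(** At x the preimage g has modulus at least (1 - 3 d') / d', while the norm of g k is at most c /
    d' + 2: on [V] because |G| <= 1, outside because |G| <= d'. Multiplication by d' gives the
    bound. *)
Let near_max_bound V d k (c : R) x : near_max V d x -> ua_inv A k ->
  0 <= c -> (forall z, V z -> nrm (S k z) <= c) -> d * supnorm (S k) <= c -> d < 3^-1 ->
  (1 - 3 * d) * nrm (k x) <= c + 2 * d.
Proof.
move=> [d' [G [/andP[d0 dd] BG G1 GV gx]]] Ak c0 cV dc d3.
have BSk := pres_fun pS Ak.
have Sk0 : 0 <= supnorm (S k) by apply: supnorm_ge0 => //; apply: ctsB; exact: ua_inv_sub.
have dn0 : of_real d'^-1 != 0 :> cplx R by apply: real_neq0; rewrite invr_gt0.
have BdG := scale_inv dn0 BG.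
set g := S' _ in gx.
have Ag : ua_inv A g := pres_fun' pS BdG.
have := preserver_coarse compactX compactY uaA uaB pS Ag Ak.
rewrite {2}/g (presK' pS) // => h.
have h1 : supnorm (of_real d'^-1 *: G * S k) <= d'^-1 * c.
  apply: supnorm_le => [|z]; first by rewrite mulr_ge0 // invr_ge0 ltW.
  rewrite -[(_ * S k) z]/(of_real d'^-1 * G z * S k z) !nrmM nrm_real.
  rewrite ger0_norm ?invr_ge0 ?(ltW d0) // -mulrA ler_pM2l ?invr_gt0 //.
  have [Vz|nVz] := pselect (V z).
    by rewrite -[leRHS]mul1r ler_pM ?nrm_ge0 //; exact: cV.
  apply: le_trans dc; rewrite ler_pM ?nrm_ge0 //.
    exact: le_trans (GV _ nVz) dd.
  by apply: nrm_le_supnorm => //; apply: ctsB; exact: ua_inv_sub.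
have h2 : nrm (g x) * nrm (k x) <= d'^-1 * c + 2.
  rewrite -nrmM; apply: le_trans (_ : supnorm (g * k) <= _); last by lra.
  apply: (@nrm_le_supnorm _ _ compactX (g * k)).
  by apply: ctsA; apply: ua_mul => //; exact: ua_inv_sub.
have h3 : d' * (nrm (g x) * nrm (k x)) <= c + 2 * d'.
  by rewrite -ler_pdivlMl // mulrDr [_ * (2 * d')]mulrCA mulVf ?gt_eqF // mulr1.
have h4 : (1 - 3 * d') * nrm (k x) <= d' * nrm (g x) * nrm (k x).
  by rewrite ler_wpM2r // nrm_ge0.
have k0 := nrm_ge0 (k x).
have h5 : d' * nrm (k x) <= d * nrm (k x) by rewrite ler_wpM2r.
nra.
Qed.

(** The sets [near_max V d] form a filter base as [V] and [d] shrink, and any cluster point x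
    satisfies |k x| <= |S k y| for all k at once. The reverse inequality is the same one for 1 /
    k. *)
Lemma modulus_point y : choquet B y ->
  exists x, forall k, ua_inv A k -> nrm (k x) = nrm (S k y).
Proof.
move=> chy.
pose I := [set i : set Y * R | [/\ open i.1, i.1 y & 0 < i.2 < 1]].
pose D := filter_from I (fun i => near_max i.1 i.2).
have PD : ProperFilter D.
  apply: filter_from_proper; last by move=> [V d] [oV Vy d01]; exact: (near_max_neq0 chy oV Vy d01).
  apply: filter_from_filter.
    exists (setT, 2^-1); split=> //=; first exact: openT.
    by rewrite invr_gt0 invf_lt1 //; lra.
  move=> [V d] [U e] [oV Vy /= /andP[d0 d1]] [oU Uy /= /andP[e0 e1]].
  exists (V `&` U, Num.min d e).
    split=> /=; [exact: openI|by []|].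
    by rewrite lt_min d0 e0 gt_min d1.
  move=> x [d' [G [/andP[d'0]]]]; rewrite le_min => /andP[d'd d'e] BG G1 GV gx.
  split; exists d', G; rewrite ?d'0; split=> // z nz.
    by apply: GV => -[].
  by apply: GV => -[].
have [|x [_ clx]] := compactX PD.
  exists (setT, 2^-1) => //; split=> //=; first exact: openT.
  by rewrite invr_gt0 invf_lt1 //; lra.
exists x.
suff le k : ua_inv A k -> nrm (k x) <= nrm (S k y).
  move=> k Ak; apply/eqP; rewrite eq_le le //=.
  have := le _ (ua_inv_inv Ak); rewrite (preserver_inv compactX compactY uaB pS) //.
  rewrite !nrmV lef_pV2 // posrE nrm_gt0; first exact: ua_inv_neq0 Ak.
  exact: ua_inv_neq0 (pres_fun pS Ak).
move=> Ak; apply/ler_addgt0Pr => e e0.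
have BSk := pres_fun pS Ak.
set a := nrm (S k y); have a0 : 0 <= a := nrm_ge0 _.
set n := supnorm (S k).
have n0 : 0 <= n by apply: supnorm_ge0 => //; apply: ctsB; exact: ua_inv_sub.
(* With d N = e / 2, (1 - 3 d) (a + e) is a + e / 2 + 2 d + d n, which absorbs the error 2 d of
   [near_max_bound]. *)
pose N := 2 + 3 * (a + e) + n.
have N0 : 0 < N by rewrite /N; lra.
pose d := e / 2 / N.
have d0 : 0 < d by rewrite !divr_gt0.
have dN : d * N = e / 2 by rewrite divfK // gt_eqF.
have d3 : d < 3^-1.
  rewrite ltr_pdivrMr // /N; lra.
pose V := [set z | nrm (S k z) < a + e / 2].
have oV : open V.
  have -> : V = (fun z => nrm (S k z)) @^-1` [set r | r < a + e / 2] by [].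
  apply: open_comp; last exact: open_lt.
  by move=> z _; apply: continuous_nrm; apply: ctsB; exact: ua_inv_sub.
have Vy : V y by rewrite /V /= -/a; lra.
have cl : closed [set z | nrm (k z) <= a + e].
  have -> : [set z | nrm (k z) <= a + e] = (fun z => nrm (k z)) @^-1` [set r | r <= a + e].
    by [].
  apply: closed_comp; last exact: closed_le.
  by move=> z _; apply: continuous_nrm; apply: ctsA; exact: ua_inv_sub.
suff DK : D [set z | nrm (k z) <= a + e] by apply: cl => U nU; exact: clx.
exists (V, d).
  by split=> //=; rewrite d0; lra.
move=> z /= hz.
have := near_max_bound hz Ak (c := a + e / 2) _ _ _ d3.
have c0 : 0 <= a + e / 2 by lra.
have dn : d * n <= a + e / 2.
  suff : d * n <= d * N by lra.
  by rewrite ler_pM2l // /N; lra.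
move=> /(_ c0 (fun z h => ltW h) dn) h.
have dd : 0 < 1 - 3 * d by lra.
rewrite -(ler_pM2l dd); apply: le_trans h _.
have dn0 : 0 <= d * n by rewrite mulr_ge0 // ltW.
have E : d * N = 2 * d + 3 * d * (a + e) + d * n by rewrite /N; ring.
rewrite mulrBl mul1r; lra.
Qed.

End ModulusPoint.

(** * From moduli to values *)

Section PointValue.
Variables (R : realType) (X Y : topologicalType).
Variables (A : set (X -> cplx R)) (B : set (Y -> cplx R)).
Hypotheses (compactX : compact [set: X]) (compactY : compact [set: Y]).
Hypotheses (uaA : uniform_algebra A) (uaB : uniform_algebra B).
Variables (S : (X -> cplx R) -> (Y -> cplx R)) (S' : (Y -> cplx R) -> (X -> cplx R)).
Hypothesis pS : preserver A B S S'.
Implicit Types (f g k l : X -> cplx R) (F G : Y -> cplx R).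

Let ctsA f : A f -> continuous f := ua_continuous uaA (f := f).
Let ctsB F : B F -> continuous F := ua_continuous uaB (f := F).
Let pS' : preserver B A S' S := preserver_sym uaA pS.

(** The product attains its maximum modulus at a Choquet point of [X], where the moduli of the
    factors transfer one by one. Products are thus controlled although [S] is not known to be
    multiplicative. *)
Lemma modulus_bound f g k x : ua_inv A f -> ua_inv A g -> ua_inv A k ->
  exists y, nrm (f x) * nrm (g x) * nrm (k x) <=
            nrm (S f y) * nrm (S g y) * nrm (S k y).
Proof.
move=> Af Ag Ak.
have Afgk : A (f * g * k) by apply: ua_inv_sub; do 2?apply: ua_inv_mul.
have [z chz zmax] := choquet_nrm_max compactX uaA x Afgk.
have [y hy] := modulus_point compactY compactX uaB uaA pS' chz.
exists y.
have E j : ua_inv A j -> nrm (j z) = nrm (S j y).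
  by move=> Aj; rewrite (hy (S j)) ?(presK pS) //; exact: (pres_fun pS).
have := nrm_le_supnorm compactX x (ctsA Afgk); rewrite -zmax.
rewrite -[(f * g * k) x]/(f x * g x * k x) -[(f * g * k) z]/(f z * g z * k z) !nrmM.
by rewrite (E _ Af) (E _ Ag) (E _ Ak).
Qed.

Lemma open_dist_lt F (a : cplx R) (r : R) : B F -> open [set z | nrm (F z - a) < r].
Proof.
move=> BF; have BG : B (F - cst a) by apply: ua_sub => //; exact: ua_cst.
have -> : [set z | nrm (F z - a) < r] =
    (fun z => nrm ((F - cst a) z)) @^-1` [set t | t < r] by [].
apply: open_comp; last exact: open_lt.
by move=> z _; exact: (continuous_nrm (ctsB BG)).
Qed.

Lemma addcst_inv f (c : R) : A f -> supnorm f < c ->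
  ua_inv A (f + cst (of_real c)) /\ ua_inv A (f + cst (- of_real c)).
Proof.
move=> Af fc; have f0 : 0 <= supnorm f by apply: supnorm_ge0 => //; exact: ctsA.
have h x : nrm (f x) <= supnorm f by apply: nrm_le_supnorm => //; exact: ctsA.
by split; apply: (ua_inv_addcst uaA Af) h; rewrite ?nrmN nrm_real ger0_norm //; lra.
Qed.

(** As |z - 1|^2 = |z|^2 - 2 re z + 1, a distance to 1 close to M + 1 with |z| <= M forces re z
    close to - M. *)
Lemma peak_location (z : cplx R) (M d : R) : 0 < M -> 0 < d < 1 -> nrm z <= M ->
  M * (1 - d) + 1 <= nrm (z - 1) ->
  M * (1 - d) <= nrm z /\ nrm (z + of_real M) ^+ 2 <= 2 * M ^+ 2 * d * (1 + M).
Proof.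
move=> M0 /andP[d0 d1] zM h; split.
  by have := nrmB z 1; rewrite nrm1; lra.
have h0 : 0 <= M * (1 - d) + 1 by rewrite addr_ge0 // mulr_ge0 ?subr_ge0 ?(ltW M0) ?(ltW d1).
have n0 := nrm_ge0 z.
have h2 : (M * (1 - d) + 1) ^+ 2 <= nrm (z - 1) ^+ 2.
  by rewrite lerXn2r // nnegrE ?nrm_ge0.
have z2 : nrm z ^+ 2 <= M ^+ 2 by rewrite lerXn2r // nnegrE ltW.
move: h2 z2; rewrite !nrm_sqr !cE subr0 addr0 => h2 z2.
have M2 : 0 <= M * (M ^+ 2 * d ^+ 2) by rewrite mulr_ge0 ?(ltW M0) // mulr_ge0 ?sqr_ge0.
have h3 : M * ((M * (1 - d) + 1) ^+ 2) <= M * ((re z - 1) ^+ 2 + im z ^+ 2).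
  by rewrite ler_pM2l.
have z3 : M * (re z ^+ 2 + im z ^+ 2) <= M * M ^+ 2 by rewrite ler_pM2l.
lra.
Qed.

(** Parallelogram identity. Two discs of radius slightly above C about C and - C meet in a thin lens
    around 0. *)
Lemma lens_bound (D : cplx R) (C u : R) : 0 <= C + u ->
  nrm (D + of_real C) <= C + u -> nrm (D - of_real C) <= C + u ->
  nrm D ^+ 2 <= 2 * C * u + u ^+ 2.
Proof.
move=> p b1 b2.
have : nrm (D + of_real C) ^+ 2 <= (C + u) ^+ 2.
  by rewrite lerXn2r // nnegrE nrm_ge0.
have : nrm (D - of_real C) ^+ 2 <= (C + u) ^+ 2.
  by rewrite lerXn2r // nnegrE nrm_ge0.
rewrite !nrm_sqr !cE subr0 addr0; lra.
Qed.

(* The right-hand side bounds [|M a w + 1|], with [a = S k y / S l y], for [w] in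
   the disc of diameter [0, 1], which contains the values of the peaking function. *)
Lemma disc_inequality k l x y : ua_inv A k -> ua_inv A l -> choquet B y ->
  (forall f, ua_inv A f -> nrm (f x) = nrm (S f y)) ->
  forall M : R, 0 < M ->
  nrm (of_real M * (k x / l x) + 1) <=
    nrm (1 + of_real (M / 2) * (S k y / S l y)) + M / 2 * nrm (S k y / S l y).
Proof.
move=> Ak Al chy mod M M0.
have BSk := pres_fun pS Ak; have BSl := pres_fun pS Al.
have [b bE] : exists b, b = k x / l x by exists (k x / l x).
have [a aE] : exists a, a = S k y / S l y by exists (S k y / S l y).
rewrite -bE -aE.
have ab : nrm b = nrm a by rewrite bE aE !nrm_div (mod _ Ak) (mod _ Al).
have [q [Aq qE]] : exists q, A q /\ forall w, q w = k w / l w.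
  exists (k * (fun w => (l w)^-1)); split=> //.
  by apply: ua_inv_sub; apply: ua_inv_mul => //; exact: ua_inv_inv.
have Aq0 : A (q - cst b) by apply: ua_sub => //; exact: ua_cst.
(* If [m1] and [m2] have modulus nearly at most [C] at some point, then [q] is
   close to [b] there. *)
have [C [m1 [m2 [C0 Am1 Am2 m1E m2E]]]] : exists C m1 m2,
    [/\ 0 < C, ua_inv A m1, ua_inv A m2, forall w, m1 w = q w - b + of_real C
       & forall w, m2 w = q w - b - of_real C].
  exists (supnorm (q - cst b) + 1), (q - cst b + cst (of_real (supnorm (q - cst b) + 1))),
    (q - cst b + cst (- of_real (supnorm (q - cst b) + 1))).
  have lt1 : supnorm (q - cst b) < supnorm (q - cst b) + 1 by rewrite ltrDl.
  have [h1 h2] := addcst_inv Aq0 lt1.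
  by split=> //; rewrite ltr_wpDl // supnorm_ge0 //; exact: ctsA.
have qx : q x - b = 0 by rewrite qE bE subrr.
have m1y : nrm (S m1 y) = C.
  by rewrite -(mod _ Am1) m1E qx add0r nrm_real gtr0_norm.
have m2y : nrm (S m2 y) = C.
  by rewrite -(mod _ Am2) m2E qx sub0r nrmN nrm_real gtr0_norm.
have [r [Br rE]] : exists r, B r /\ forall w, r w = S k w / S l w.
  exists (S k * (fun w => (S l w)^-1)); split=> //.
  by apply: ua_inv_sub; apply: ua_inv_mul => //; exact: ua_inv_inv.
have Bm1 := ua_inv_sub (pres_fun pS Am1); have Bm2 := ua_inv_sub (pres_fun pS Am2).
set N1 := supnorm (S m1); set N2 := supnorm (S m2); set N3 := supnorm r.
have N10 : 0 <= N1 by apply: supnorm_ge0 => //; exact: ctsB.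
have N20 : 0 <= N2 by apply: supnorm_ge0 => //; exact: ctsB.
have N30 : 0 <= N3 by apply: supnorm_ge0 => //; exact: ctsB.
set T := nrm (1 + _) + _.
have T1 : 1 <= T.
  have := nrmB (1 + of_real (M / 2) * a) (of_real (M / 2) * a).
  by rewrite addrK nrm1 nrmM nrm_real ger0_norm // divr_ge0 // ltW.
pose c := 2 * C + 2.
(* Per unit of e, the summands pay for the error in [up], for replacing z by - M, and for replacing
   q x' by b. *)
pose K := M + 2 * M * (1 + M) * nrm a + M * (2 * c).
have K0 : 0 <= K.
  by rewrite /K /c !addr_ge0 ?mulr_ge0 ?nrm_ge0 //; lra.
suff main (e : R) : 0 < e < 2^-1 -> nrm (of_real M * b + 1) <= T + K * e.
  apply/ler_addgt0Pr => e e0.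
  pose e' := Num.min 4^-1 (e / (K + 1)).
  have K1 : 0 < K + 1 by lra.
  have e'0 : 0 < e' by rewrite lt_min divr_gt0 // andbT invr_gt0.
  have e'1 : e' <= 4^-1 by rewrite ge_min lexx.
  have e'2 : e' <= e / (K + 1) by rewrite ge_min lexx orbT.
  have h1 : e' * (K + 1) <= e by rewrite -ler_pdivlMr.
  have := main e'; rewrite e'0 /= => h.
  have := h _; have -> : e' < 2^-1 by lra.
  move=> /(_ isT); lra.
move=> /andP[e0 e1].
(* [peak_location] and [lens_bound] control squares of distances: errors of order h there give
   distances of order e. *)
pose h := e ^+ 2; have h0 : 0 < h by rewrite exprn_gt0.
have he : h <= e by rewrite /h expr2; nra.
have h1 : h < 2^-1 by apply: le_lt_trans he e1.
pose N := 1 + N1 + N2 + N3; have N0 : 1 <= N by rewrite /N; lra.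
(* Outside [V] the peaking function is at most d, so its products with [S m1], [S m2] and [r] are at
   most h there. *)
pose d := h / N.
have Np : 0 < N by lra.
have d0 : 0 < d by rewrite divr_gt0.
have dN : d * N = h by rewrite divfK // gt_eqF.
have dh : d <= h by rewrite -dN; nra.
have dn (n : R) : n <= N -> d * n <= h by move=> nN; rewrite -dN ler_pM2l.
have d01 : 0 < d < 1 by rewrite d0 /=; lra.
pose V := [set z | nrm (r z - a) < h] `&`
  ([set z | nrm (S m1 z - 0) < C + h] `&` [set z | nrm (S m2 z - 0) < C + h]).
have oV : open V.
  by do 2?apply: openI; exact: open_dist_lt.
have Vy : V y.
  rewrite /V /= !subr0 m1y m2y rE aE subrr nrm0.
  by do !split => //; lra.
have [G [BG Gd GF [t /andP[t0 t1] Gt]]] :=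
  choquet_peak compactY uaB chy (open_closedC oV) (fun h => h Vy) d01.
have G1 z : nrm (G z) <= 1 by exact: peak_le1.
have Sl0 z : S l z != 0 by exact: ua_inv_neq0 BSl.
(* This makes S g * S l equal to - M G, which is near - M at y, and S g * S k equal to - M G r. *)
have [H [BH HE]] : exists H, ua_inv B H /\ forall w, H w = - of_real M * (G w / S l w).
  have Mn0 : - of_real M != 0 :> cplx R.
    by rewrite -nrm_gt0 nrmN nrm_real normr_gt0 gt_eqF.
  exists (cst (- of_real M) * (G * (fun w => (S l w)^-1))); split=> //.
  apply: (ua_inv_mul uaB (ua_inv_cst uaB Mn0)).
  by apply: (ua_inv_mul uaB BG); exact: ua_inv_inv.
have [g [Ag Sg]] : exists g, ua_inv A g /\ S g = H.
  by exists (S' H); split; [exact: (pres_fun' pS BH)|exact: (presK' pS BH)].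
have HSl z : H z * S l z = - of_real M * G z by rewrite HE -mulrA divfK.
have HSk z : H z * S k z = - of_real M * G z * r z.
  by rewrite HE rE -!mulrA; congr (_ * (_ * _)); rewrite mulrC.
have cSl : continuous (S g * S l - 1).
  apply: ctsB; apply: ua_sub => //; last exact: ua_one.
  by apply: ua_mul => //; apply: ua_inv_sub; rewrite ?Sg.
have Agl : A (g * l - 1).
  apply: ua_sub => //; last exact: ua_one.
  by apply: ua_mul => //; exact: ua_inv_sub.
have [x' hx'] := supnorm_attained compactX (ctsA Agl) x.
have lb : M * (1 - d) + 1 <= nrm (g x' * l x' - 1).
  rewrite -[g x' * l x' - 1]/((g * l - 1) x') hx' -(pres_norm pS) //.
  apply: le_trans (nrm_le_supnorm compactY y cSl).
  rewrite -[(S g * S l - 1) y]/(S g y * S l y - 1) Sg HSl Gt.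
  apply: le_trans (_ : M * t + 1 <= _); first by rewrite lerD2r ler_pM2l.
  rewrite -nrmN; apply: le_trans (re_le_nrm _); rewrite !cE; lra.
have ub2 : nrm (g x' * l x') <= M.
  have [y' hy'] := modulus_bound x' Ag Al (ua_inv_one uaA).
  move: hy'; rewrite (pres_one pS) -[(1 : X -> _) x']/(1 : cplx R).
  rewrite -[(1 : Y -> _) y']/(1 : cplx R) nrm1 !mulr1 -!nrmM Sg HSl.
  move=> /le_trans; apply; rewrite nrmM nrmN nrm_real gtr0_norm //.
  by rewrite -[leRHS]mulr1 ler_pM2l.
have [zlb zM] := peak_location M0 d01 ub2 lb.
have [z zE] : exists z, z = g x' * l x' by exists (g x' * l x').
rewrite -zE in ub2 zlb zM.
have zMe : nrm (z + of_real M) <= 2 * M * (1 + M) * e.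
  have M1 : 0 <= 1 + M by lra.
  have p : 0 <= 2 * M * (1 + M) * e by rewrite !mulr_ge0 ?(ltW M0) ?(ltW e0).
  rewrite -ler_sqr ?nnegrE ?nrm_ge0 //; apply: le_trans zM _.
  have -> : (2 * M * (1 + M) * e) ^+ 2 = 4 * M ^+ 2 * (1 + M) * (h * (1 + M)).
    by rewrite /h; ring.
  have -> : 2 * M ^+ 2 * d * (1 + M) = 4 * M ^+ 2 * (1 + M) * (d / 2) by field.
  have M2 : 0 <= 4 * M ^+ 2 * (1 + M).
    by rewrite mulr_ge0 // mulr_ge0 // sqr_ge0.
  apply: ler_wpM2l => //; nra.
have HSl' w : S g w * S l w = - of_real M * G w by rewrite Sg HSl.
(* At the point y' of [modulus_bound], |G| <= 1 if y' is in [V] and |G| <= d otherwise; in both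
   cases |z m(x')| <= M (C + h), and |z| is close to M. *)
have loc m : ua_inv A m -> d * supnorm (S m) <= h ->
    (forall w, V w -> nrm (S m w) <= C + h) -> (1 - h) * nrm (m x') <= C + h.
  move=> Am dm Vm.
  have [y' hy'] := modulus_bound x' Ag Al Am.
  rewrite -!nrmM -zE HSl' !nrmM nrmN nrm_real gtr0_norm // in hy'.
  have h2 : nrm (G y') * nrm (S m y') <= C + h.
    have [Vy'|nVy'] := pselect (V y').
      by rewrite -[leRHS]mul1r ler_pM ?nrm_ge0 //; exact: Vm.
    apply: le_trans (_ : h <= _); last by lra.
    apply: le_trans dm; rewrite ler_pM ?nrm_ge0 //; first exact: GF.
    exact: (nrm_le_supnorm compactY y' (ctsB (ua_inv_sub (pres_fun pS Am)))).
  rewrite -(ler_pM2l M0) mulrA.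
  have h3 : M * (1 - h) * nrm (m x') <= nrm z * nrm (m x').
    apply: ler_wpM2r; first exact: nrm_ge0.
    by apply: le_trans zlb; rewrite ler_pM2l //; lra.
  apply: le_trans h3 (le_trans hy' _).
  by rewrite -mulrA ler_pM2l.
have loc' m : ua_inv A m -> d * supnorm (S m) <= h ->
    (forall w, V w -> nrm (S m w) <= C + h) -> nrm (m x') <= C + c * h.
  move=> Am dm Vm; have := loc m Am dm Vm; have := nrm_ge0 (m x').
  have p : 0 < 1 - h by lra.
  move=> _ h2; rewrite -(ler_pM2l p); apply: le_trans h2 _.
  (* The product is (1 - h) (C + c h) - (C + h) for c = 2 C + 2; it is nonnegative since h < 1/2. *)
  have w0 : 0 <= h * (C + 1) * (1 - 2 * h) by apply: mulr_ge0; [apply: mulr_ge0|]; lra.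
  rewrite /c; lra.
have [D DE] : exists D, D = q x' - b by exists (q x' - b).
have b1 : nrm (D + of_real C) <= C + c * h.
  rewrite DE -m1E; apply: (loc' m1 Am1); first by apply: dn; rewrite -/N1 /N; lra.
  by move=> w [_ [/= hw _]]; rewrite subr0 in hw; exact: ltW.
have b2 : nrm (D - of_real C) <= C + c * h.
  rewrite DE -m2E; apply: (loc' m2 Am2); first by apply: dn; rewrite -/N2 /N; lra.
  by move=> w [_ [/= _ hw]]; rewrite subr0 in hw; exact: ltW.
have c0 : 0 < c by rewrite /c; lra.
have De : nrm D <= 2 * c * e.
  have p : 0 <= 2 * c * e by rewrite mulr_ge0 ?(ltW e0) // mulr_ge0 // ltW.
  have p2 : 0 <= C + c * h by rewrite addr_ge0 ?mulr_ge0 // ltW.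
  rewrite -ler_sqr ?nnegrE ?nrm_ge0 //; apply: le_trans (lens_bound p2 b1 b2) _.
  have -> : (2 * c * e) ^+ 2 = 4 * c ^+ 2 * h by rewrite /h; ring.
  have hh : c ^+ 2 * (h * h) <= c ^+ 2 * h.
    by apply: ler_wpM2l; [exact: sqr_ge0|rewrite ger_pMr //; lra].
  have cC : 2 * C * (c * h) <= c ^+ 2 * h.
    rewrite expr2 -[leRHS]mulrA; apply: ler_wpM2r; last by rewrite /c; lra.
    by rewrite mulr_ge0 // ltW.
  have -> : (c * h) ^+ 2 = c ^+ 2 * (h * h) by ring.
  have : 0 <= c ^+ 2 * h by rewrite mulr_ge0 ?sqr_ge0 // ltW.
  lra.
have gk : g x' * k x' = z * q x'.
  rewrite zE qE -mulrA [l x' * _]mulrC divfK //.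
  exact: ua_inv_neq0 Al.
have cSk : continuous (S g * S k - 1).
  apply: ctsB; apply: ua_sub => //; last exact: ua_one.
  by apply: ua_mul => //; apply: ua_inv_sub; rewrite ?Sg.
have Agk : A (g * k - 1).
  apply: ua_sub => //; last exact: ua_one.
  by apply: ua_mul => //; exact: ua_inv_sub.
have up : nrm (z * q x' - 1) <= T + M * h.
  rewrite -gk -[g x' * k x' - 1]/((g * k - 1) x').
  apply: le_trans (nrm_le_supnorm compactX x' (ctsA Agk)) _.
  rewrite -(pres_norm pS) //; apply: supnorm_le => [|w].
    by rewrite addr_ge0 ?mulr_ge0 ?(ltW M0) ?(ltW h0) //; lra.
  rewrite -[(S g * S k - 1) w]/(S g w * S k w - 1) Sg HSk.
  have [Vw|nVw] := pselect (V w).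
    have rw : nrm (r w - a) <= h by apply: ltW; case: Vw.
    pose v := G w - of_real 2^-1.
    have v1 : nrm v <= 2^-1 by exact: Gd.
    have -> : - of_real M * G w * r w - 1 = - ((1 + of_real (M / 2) * a)
        + of_real M * v * a + of_real M * G w * (r w - a)).
      have -> : of_real (M / 2) = of_real M * of_real 2^-1 :> cplx R by exact: of_realM.
      rewrite /v; ring.
    rewrite nrmN; apply: le_trans (nrmD _ _) _; rewrite /T lerD //.
      apply: le_trans (nrmD _ _) _; rewrite lerD2l !nrmM nrm_real gtr0_norm //.
      by rewrite ler_wpM2r ?nrm_ge0 // ler_pM2l.
    rewrite !nrmM nrm_real gtr0_norm // -mulrA ler_pM2l // -[leRHS]mul1r.
    by rewrite ler_pM ?nrm_ge0.
  apply: le_trans (nrmB _ _) _; rewrite nrm1 !nrmM nrmN nrm_real gtr0_norm //.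
  rewrite addrC lerD // -mulrA ler_pM2l //.
  apply: le_trans (dn N3 _); last by rewrite /N; lra.
  rewrite ler_pM ?nrm_ge0 //; first exact: GF.
  exact: (nrm_le_supnorm compactY w (ctsB Br)).
(* As z is near - M and D near 0, only the last term, bounded by [up], is not small. *)
have -> : of_real M * b + 1 = (z + of_real M) * b + z * D - (z * q x' - 1).
  by rewrite DE; ring.
apply: le_trans (nrmB _ _) _.
have j1 := nrmD ((z + of_real M) * b) (z * D).
have j2 : nrm ((z + of_real M) * b) <= 2 * M * (1 + M) * nrm a * e.
  by rewrite nrmM ab mulrAC ler_wpM2r // nrm_ge0.
have j3 : nrm (z * D) <= M * (2 * c) * e.
  by rewrite nrmM -mulrA ler_pM ?nrm_ge0.
have j4 : M * h <= M * e by rewrite ler_pM2l.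
rewrite /K; lra.
Qed.

Lemma quotient_re_le k l x y : ua_inv A k -> ua_inv A l -> choquet B y ->
  (forall f, ua_inv A f -> nrm (f x) = nrm (S f y)) ->
  re (k x / l x) <= re (S k y / S l y).
Proof.
move=> Ak Al chy mod; apply: re_le_of_disc; first by rewrite !nrm_div (mod _ Ak) (mod _ Al).
exact: disc_inequality.
Qed.

(* The preimage of [- S k] takes the value [- k x] at [x]. *)
Lemma quotient_re k l x y : ua_inv A k -> ua_inv A l -> choquet B y ->
  (forall f, ua_inv A f -> nrm (f x) = nrm (S f y)) ->
  re (k x / l x) = re (S k y / S l y).
Proof.
move=> Ak Al chy mod; apply/eqP; rewrite eq_le quotient_re_le //=.
have BSk := pres_fun pS Ak.
have BNk : ua_inv B (cst (-1) * S k).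
  have n0 : -1 != 0 :> cplx R by rewrite oppr_eq0 oner_eq0.
  exact: (ua_inv_mul uaB (ua_inv_cst uaB n0)).
pose k' := S' (cst (-1) * S k).
have Ak' : ua_inv A k' := pres_fun' pS BNk.
have Sk' : S k' y = - S k y by rewrite (presK' pS) // -[LHS]/(-1 * S k y) mulN1r.
have kx0 : k x != 0 by exact: ua_inv_neq0 Ak.
have Sk0 : S k y != 0 by exact: ua_inv_neq0 BSk.
(* At x the quotient k' / k has real part at most - 1 and modulus 1, so it is - 1. *)
have := quotient_re_le Ak' Ak chy mod; rewrite Sk' mulNr divff // reN re1 => h.
have n1 : nrm (k' x / k x) = 1.
  by rewrite nrm_div (mod _ Ak') (mod _ Ak) Sk' nrmN divff // nrm_eq0.
have E : k' x = - k x.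
  have u : k' x / k x = -1.
    have := nrm_sqr (k' x / k x); rewrite n1 expr1n => e1.
    have r1 : re (k' x / k x) = -1.
      have := ler_re_nrm (k' x / k x); rewrite n1 ler_norml => /andP[h1 _].
      by apply/eqP; rewrite eq_le h h1.
    apply: cplx_eq; first by rewrite r1 reN re1.
    rewrite imN im1 oppr0; move: e1; rewrite r1 sqrrN expr1n => e1.
    by apply/eqP; rewrite -sqrf_eq0; apply/eqP; lra.
  by rewrite -[LHS](divfK kx0) u mulN1r.
have := quotient_re_le Ak' Al chy mod.
by rewrite Sk' E !mulNr !reN lerN2.
Qed.

(* Composition with the identity or the conjugation, chosen by [S i]. *)
Lemma point_value y : choquet B y -> exists x,
  (S (cst (ii R)) y = ii R /\ forall k, ua_inv A k -> S k y = k x) \/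
  (S (cst (ii R)) y = - ii R /\ forall k, ua_inv A k -> S k y = Num.conj (k x)).
Proof.
move=> chy; have [x mod] := modulus_point compactX compactY uaA uaB pS chy.
exists x.
have i0 : ii R != 0 by rewrite -nrm_gt0 nrm_ii.
have Ai : ua_inv A (cst (ii R)) by exact: ua_inv_cst.
have Ere k : ua_inv A k -> re (k x) = re (S k y).
  move=> Ak; have := quotient_re Ak (ua_inv_one uaA) chy mod.
  by rewrite (pres_one pS) -[(1 : X -> _) x]/(1 : cplx R) -[(1 : Y -> _) y]/(1 : cplx R) !divr1.
(* Im w = Re (w / i), so imaginary parts are real parts of quotients by the constant i. *)
have Eim k : ua_inv A k -> im (k x) = re (S k y / S (cst (ii R)) y).
  move=> Ak; rewrite -(quotient_re Ak Ai chy mod) -[cst _ x]/(ii R).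
  have -> : (ii R)^-1 = - ii R by apply: (mulfI i0); rewrite divff // mulrN ii_sqr opprK.
  by rewrite !cE; ring.
have r0 : re (S (cst (ii R)) y) = 0 by rewrite -(Ere _ Ai).
have m1 : im (S (cst (ii R)) y) ^+ 2 = 1.
  have := nrm_sqr (S (cst (ii R)) y); rewrite -(mod _ Ai) -[cst _ x]/(ii R) nrm_ii r0.
  by rewrite expr1n expr0n add0r => <-.
have : (im (S (cst (ii R)) y) == 1) || (im (S (cst (ii R)) y) == -1).
  by rewrite -sqrf_eq1 m1.
case/orP => /eqP mi.
  have Si : S (cst (ii R)) y = ii R by exact: cplx_eq.
  left; split=> // k Ak; apply: cplx_eq; first by rewrite (Ere _ Ak).
  rewrite (Eim _ Ak) Si.
  have -> : (ii R)^-1 = - ii R by apply: (mulfI i0); rewrite divff // mulrN ii_sqr opprK.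
  by rewrite !cE; ring.
have Si : S (cst (ii R)) y = - ii R by apply: cplx_eq; rewrite ?r0 ?mi !cE ?oppr0.
right; split=> // k Ak; apply: cplx_eq; rewrite !cE; first by rewrite (Ere _ Ak).
rewrite (Eim _ Ak) Si.
have -> : (- ii R)^-1 = ii R.
  by apply: (mulfI (_ : - ii R != 0)); rewrite ?oppr_eq0 // divff ?oppr_eq0 // mulNr ii_sqr opprK.
by rewrite !cE; ring.
Qed.

End PointValue.

(** * The extension to the whole algebra *)

Section Extension.
Variables (R : realType) (X Y : topologicalType).
Variables (A : set (X -> cplx R)) (B : set (Y -> cplx R)).
Hypotheses (compactX : compact [set: X]) (compactY : compact [set: Y]).
Hypotheses (uaA : uniform_algebra A) (uaB : uniform_algebra B).
Variables (S : (X -> cplx R) -> (Y -> cplx R)) (S' : (Y -> cplx R) -> (X -> cplx R)).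
Hypothesis pS : preserver A B S S'.
Implicit Types (f g k : X -> cplx R) (F G : Y -> cplx R).

Definition id_or_conj (b : bool) (z : cplx R) := if b then z else Num.conj z.

Lemma id_or_conjD b z w : id_or_conj b (z + w) = id_or_conj b z + id_or_conj b w.
Proof. by case: b => //; exact: rmorphD. Qed.

Lemma id_or_conjM b z w : id_or_conj b (z * w) = id_or_conj b z * id_or_conj b w.
Proof. by case: b => //; exact: rmorphM. Qed.

Lemma id_or_conj_real b (r : R) : id_or_conj b (of_real r) = of_real r.
Proof. by case: b => //; apply: cplx_eq; rewrite /id_or_conj !cE ?oppr0. Qed.

Lemma nrm_id_or_conj b z : nrm (id_or_conj b z) = nrm z.
Proof. by case: b => //; exact: nrm_conj. Qed.

Lemma re_id_or_conj b z : re (id_or_conj b z) = re z.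
Proof. by case: b => //; exact: re_conj. Qed.

(** Whether conjugation occurs is read off [S i] at [y], hence depends on [y] alone. *)
Definition matched x y := forall k, ua_inv A k ->
  S k y = id_or_conj (S (cst (ii R)) y == ii R) (k x).

Lemma choquet_matched y : choquet B y -> exists x, matched x y.
Proof.
move=> chy; have [x [[Si hx]|[Si hx]]] := point_value compactX compactY uaA uaB pS chy.
  by exists x => k Ak; rewrite Si eqxx hx.
exists x => k Ak; rewrite Si hx //.
case: eqP => // /(congr1 (@im R)) h; exfalso; move: h; rewrite !cE; lra.
Qed.

(** The maximum of |F - G| is attained on the Choquet boundary. Identities in [B] are thereby
    reduced to points where [S] acts explicitly. *)
Lemma choquet_determining F G : B F -> B G ->
  (forall y, choquet B y -> F y = G y) -> F = G.
Proof.
move=> BF BG FG; apply/funext => y.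
have BD := ua_sub uaB BF BG.
have [z chz zmax] := choquet_nrm_max compactY uaB y BD.
have := nrm_le_supnorm compactY y (ua_continuous uaB BD).
rewrite -zmax -[(F - G) z]/(F z - G z) FG // subrr nrm0 => h.
by apply/eqP; rewrite -subr_eq0 -nrm_eq0 eq_le h nrm_ge0.
Qed.

Definition shift_cst f : R := supnorm f + 1.

(** f + c is invertible for real c above the norm of f, and subtracting c again is consistent
    because conjugation fixes real constants. *)
Definition extension f : Y -> cplx R :=
  S (f + cst (of_real (shift_cst f))) - cst (of_real (shift_cst f)).

Lemma shift_inv f : A f -> ua_inv A (f + cst (of_real (shift_cst f))).
Proof.
move=> Af; have lt1 : supnorm f < shift_cst f by rewrite ltrDl.
by have [] := addcst_inv compactX uaA Af lt1.
Qed.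

Lemma extension_in f : A f -> B (extension f).
Proof.
move=> Af; apply: ua_sub => //; last exact: ua_cst.
by apply: ua_inv_sub; apply: (pres_fun pS); exact: shift_inv.
Qed.

Lemma extension_matched f x y : matched x y -> A f ->
  extension f y = id_or_conj (S (cst (ii R)) y == ii R) (f x).
Proof.
move=> xy Af; rewrite -[LHS]/(S _ y - of_real (shift_cst f)) (xy _ (shift_inv Af)).
rewrite -[(f + _) x]/(f x + of_real (shift_cst f)).
by rewrite id_or_conjD id_or_conj_real addrK.
Qed.

Lemma extensionE f : ua_inv A f -> extension f = S f.
Proof.
move=> Af; have Af' := ua_inv_sub Af.
apply: choquet_determining; first exact: extension_in.
  by apply: ua_inv_sub; exact: (pres_fun pS).
by move=> y /choquet_matched[x xy]; rewrite (extension_matched xy) // (xy _ Af).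
Qed.

Lemma extension_linear (r : R) f g : A f -> A g ->
  extension (of_real r *: f + g) = of_real r *: extension f + extension g.
Proof.
move=> Af Ag; have Arf := ua_scale uaA (of_real r) Af.
apply: choquet_determining; first by apply: extension_in; exact: ua_add.
  apply: ua_add => //; last exact: extension_in.
  by apply: ua_scale => //; exact: extension_in.
move=> y /choquet_matched[x xy].
rewrite -[RHS]/(of_real r * extension f y + extension g y).
rewrite !(extension_matched xy) //; last exact: ua_add.
rewrite -[(_ + g) x]/(of_real r * f x + g x).
by rewrite id_or_conjD id_or_conjM id_or_conj_real.
Qed.

Lemma extension_mul f g : A f -> A g -> extension (f * g) = extension f * extension g.
Proof.
move=> Af Ag; apply: choquet_determining.
- by apply: extension_in; exact: ua_mul.
- by apply: ua_mul => //; exact: extension_in.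
move=> y /choquet_matched[x xy].
rewrite -[RHS]/(extension f y * extension g y).
rewrite !(extension_matched xy) //; last exact: ua_mul.
by rewrite -id_or_conjM.
Qed.

Lemma extension_one : extension 1 = 1.
Proof. by rewrite extensionE ?(pres_one pS) //; exact: ua_inv_one. Qed.

Lemma extension_cst (r : R) : extension (cst (of_real r)) = cst (of_real r).
Proof.
apply: choquet_determining.
- by apply: extension_in; exact: ua_cst.
- exact: ua_cst.
move=> y /choquet_matched[x xy].
by rewrite (extension_matched xy) ?id_or_conj_real //; exact: ua_cst.
Qed.

Lemma supnorm_extension_le f : A f -> supnorm (extension f) <= supnorm f.
Proof.
move=> Af; have cf := ua_continuous uaA Af.
apply: supnorm_le => [|y]; first exact: supnorm_ge0.
have BL := extension_in Af.
have [z /choquet_matched[x xz] zmax] := choquet_nrm_max compactY uaB y BL.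
apply: le_trans (nrm_le_supnorm compactY y (ua_continuous uaB BL)) _.
by rewrite -zmax (extension_matched xz) // nrm_id_or_conj nrm_le_supnorm.
Qed.

Lemma re_extension_le f (c : R) : A f -> (forall x, re (f x) <= c) ->
  forall y, re (extension f y) <= c.
Proof.
move=> Af fc y.
have [z /choquet_matched[x xz] zmax] := choquet_max compactY uaB y (extension_in Af).
apply: le_trans (zmax y) _.
by rewrite (extension_matched xz) // re_id_or_conj.
Qed.

End Extension.

Section ExtensionInverse.
Variables (R : realType) (X Y : topologicalType).
Variables (A : set (X -> cplx R)) (B : set (Y -> cplx R)).
Hypotheses (compactX : compact [set: X]) (compactY : compact [set: Y]).
Hypotheses (hausdorffX : hausdorff_space X).
Hypotheses (uaA : uniform_algebra A) (uaB : uniform_algebra B).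
Variables (S : (X -> cplx R) -> (Y -> cplx R)) (S' : (Y -> cplx R) -> (X -> cplx R)).
Hypothesis pS : preserver A B S S'.
Implicit Types (f g k : X -> cplx R) (F G : Y -> cplx R).

Let pS' : preserver B A S' S := preserver_sym uaA pS.
Let L := extension S.
Let L' := extension S'.

(** [L f] differs from a value of [S] by a real constant, and [L'] is real-linear and inverts [S] on
    invertible elements. *)
Lemma extensionK f : A f -> L' (L f) = f.
Proof.
move=> Af; have Asf := shift_inv compactX uaA Af.
set c := shift_cst f in Asf.
have -> : L f = of_real (- c) *: (1 : Y -> cplx R) + S (f + cst (of_real c)).
  apply/funext => y; rewrite -[LHS]/(S (f + cst (of_real c)) y - of_real c).
  rewrite -[RHS]/(of_real (- c) * 1 + S (f + cst (of_real c)) y).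
  by rewrite mulr1 of_realN addrC.
have BS := pres_fun pS Asf.
rewrite /L' (extension_linear compactY compactX uaB uaA pS') //.
- rewrite (extensionE compactY compactX uaB uaA pS' BS) (presK pS) //.
  rewrite (extension_one compactY compactX uaB uaA pS').
  apply/funext => x; rewrite -[LHS]/(of_real (- c) * 1 + (f x + of_real c)).
  by rewrite mulr1 of_realN addrCA addNr addr0.
- exact: ua_one.
- exact: ua_inv_sub.
Qed.

End ExtensionInverse.

(** * Correspondence of Choquet points *)

Section MatchedPoints.
Variables (R : realType) (X Y : topologicalType).
Variables (A : set (X -> cplx R)) (B : set (Y -> cplx R)).
Hypotheses (compactX : compact [set: X]) (compactY : compact [set: Y]).
Hypotheses (hausdorffX : hausdorff_space X).
Hypotheses (uaA : uniform_algebra A) (uaB : uniform_algebra B).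
Variables (S : (X -> cplx R) -> (Y -> cplx R)) (S' : (Y -> cplx R) -> (X -> cplx R)).
Hypothesis pS : preserver A B S S'.
Implicit Types (f g k : X -> cplx R) (F G : Y -> cplx R).

Let pS' : preserver B A S' S := preserver_sym uaA pS.
Let L := extension S.
Let L' := extension S'.

(* States of [A] are pulled back along the inverse of the extension. *)
Lemma matched_choquet x y : choquet B y -> matched A S x y -> choquet A x.
Proof.
move=> chy xy t L1 L2 t01 S1 S2 dec.
have L'in F : B F -> A (L' F) by exact: (extension_in compactY uaB uaA pS').
(* The extension is only real-linear, so just the real parts are pulled back; [complexify] rebuilds
   states of [B] from them. *)
have pull M : is_state A M ->
    real_linear_on B (fun F => re (M (L' F))) /\
    supported B (fun F => re (M (L' F))) setT.
  move=> SM; have lM := state_real_linear uaA SM; split.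
    split=> [F G BF BG|r F BF].
      have := extension_linear compactY compactX uaB uaA pS' 1 BF BG.
      rewrite of_real1 !scale1r -/L' => ->; exact: (rlinD lM (L'in _ BF) (L'in _ BG)).
    have := extension_linear compactY compactX uaB uaA pS' r BF (ua_zero uaB).
    have -> : extension S' 0 = 0.
      exact: (extension_cst compactY compactX uaB uaA pS' 0).
    rewrite !addr0 -/L' => ->; exact: (rlinZ lM r (L'in _ BF)).
  move=> F c BF Fc; apply: (state_supported compactX uaA SM (L'in _ BF)) => z _.
  by apply: (re_extension_le compactY compactX uaB uaA pS') => // w; exact: Fc.
have [l1 p1] := pull _ S1; have [l2 p2] := pull _ S2.
have T1 := complexify_state compactY uaB l1 p1.
have T2 := complexify_state compactY uaB l2 p2.
have reL f : A f -> re (L f y) = re (f x).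
  move=> Af; rewrite /L (extension_matched compactX uaA xy) //.
  exact: re_id_or_conj.
have decB F : B F ->
    re (F y) = t * re (L1 (L' F)) + (1 - t) * re (L2 (L' F)).
  move=> BF; have E : L (L' F) = F := extensionK compactY compactX uaB uaA pS' BF.
  rewrite -{1}E reL; last exact: L'in.
  by rewrite dec ?cE ?mul0r ?subr0 //; exact: L'in.
have eqB := chy t _ _ t01 T1 T2 (complexify_convex uaB decB).
have reeq f : A f -> re (L1 f) = re (f x) /\ re (L2 f) = re (f x).
  move=> Af; have BL := extension_in compactX uaA uaB pS Af.
  have [e1 e2] := eqB _ BL.
  have r1 : re (L1 (L' (L f))) = re (L f y) := congr1 (@re R) e1.
  have r2 : re (L2 (L' (L f))) = re (L f y) := congr1 (@re R) e2.
  have E : L' (L f) = f := extensionK compactX compactY uaA uaB pS Af.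
  by rewrite E reL in r1; rewrite E reL in r2.
by move=> f Af; split; apply: (state_dominated uaA) => // g /reeq[]; [move=> ->|move=> _ ->].
Qed.

(** Both re (F y) and re (F y') equal re (L' F x), and real parts separate points. *)
Lemma matched_unique x y y' : matched A S x y -> matched B S' y' x -> y' = y.
Proof.
move=> xy yx; apply: contrapT => /(ua_separates_re uaB)[F BF].
have AL := extension_in compactY uaB uaA pS' BF.
have := extension_matched compactX uaA xy AL.
rewrite (extensionK compactY compactX uaB uaA pS' BF) => ->.
by rewrite re_id_or_conj (extension_matched compactY uaB yx BF) re_id_or_conj ltxx.
Qed.

(** In a compact Hausdorff space a filter with a single cluster point converges to it; any other
    cluster point of the image filter is excluded by some re f separating it from [p z]. *)
Lemma separating_continuous (Z : topologicalType) (p : Z -> X) :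
  (forall f, A f -> continuous (fun z => re (f (p z)))) -> continuous p.
Proof.
move=> cp z.
apply: (compact_cluster_set1 hausdorffX compactX) => //; do ?exact: filterT.
apply/seteqP; split=> [x clx|_ -> U V nU nV]; last first.
  by exists (p z); split; [exact: (@nbhs_singleton _ z _ nU)|exact: nbhs_singleton].
apply: contrapT => /= xpz.
have [f Af fx] := ua_separates_re uaA xpz.
pose m := (re (f x) + re (f (p z))) / 2.
have m1 : m < re (f (p z)) by rewrite /m; lra.
have m2 : re (f x) < m by rewrite /m; lra.
have n1 : nbhs (re (f (p z))) [set r | m < r].
  by apply: open_nbhs_nbhs; split=> //; exact: open_gt.
have n2 : nbhs (re (f x)) [set r | r < m].
  by apply: open_nbhs_nbhs; split=> //; exact: open_lt.
have U1 : (p @ z) [set w | m < re (f w)] := cp f Af z _ n1.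
have U2 : nbhs x [set w | re (f w) < m] := ua_continuous_re uaA Af n2.
have [w [/= h1 h2]] := clx _ _ U1 U2.
by have := lt_trans h1 h2; rewrite ltxx.
Qed.

End MatchedPoints.

(** * The map between Choquet boundaries and its clopen set *)

Section ExtensionTheorem.
Variables (R : realType) (X Y : topologicalType).
Variables (A : set (X -> cplx R)) (B : set (Y -> cplx R)).
Hypotheses (compactX : compact [set: X]) (compactY : compact [set: Y]).
Hypothesis hausdorffX : hausdorff_space X.
Hypotheses (uaA : uniform_algebra A) (uaB : uniform_algebra B).
Variables (S : (X -> cplx R) -> (Y -> cplx R)) (S' : (Y -> cplx R) -> (X -> cplx R)).
Hypothesis pS : preserver A B S S'.
Implicit Types (f g k : X -> cplx R) (F G : Y -> cplx R).

Lemma set_val_continuous (Z : topologicalType) (C : set Z) :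
  continuous (fun z : set_type C => val z).
Proof. exact: (@initial_continuous (set_type C) Z set_val). Qed.

Lemma matched_map : exists phi : set_type (choquet B) -> set_type (choquet A),
  forall y, matched A S (val (phi y)) (val y).
Proof.
suff /choice[phi phiP] : forall y : set_type (choquet B),
    exists x : set_type (choquet A), matched A S (val x) (val y) by exists phi.
move=> y; have chy : choquet B (val y) := set_mem (valP y).
have [x xy] := choquet_matched compactX compactY uaA uaB pS chy.
have chx := matched_choquet compactX compactY uaA uaB pS chy xy.
by exists (exist _ x (mem_set chx)).
Qed.

(** Conjugation does not change real parts, so re f composed with [phi] is the restriction of the
    continuous re (extension f), wherever conjugation occurs. *)
Lemma matched_map_continuous (phi : set_type (choquet B) -> set_type (choquet A)) :
  (forall y, matched A S (val (phi y)) (val y)) -> continuous phi.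
Proof.
move=> phiP; apply: (@continuous_comp_initial _ _ _ set_val phi).
apply: (separating_continuous compactX hausdorffX uaA) => f Af.
have BL := extension_in compactX uaA uaB pS Af.
have -> : (fun y => re (f ((set_val \o phi) y))) =
    (fun z => re (extension S f z)) \o (fun y : set_type (choquet B) => val y).
  apply/funext => y /=.
  by rewrite (extension_matched compactX uaA (phiP y) Af) re_id_or_conj.
move=> y; apply: continuous_comp; first exact: set_val_continuous.
exact: (ua_continuous_re uaB BL).
Qed.

Lemma extension_bij : set_bij A B (extension S).
Proof.
have pS' := preserver_sym uaA pS.
split.
- by move=> f; exact: (extension_in compactX uaA uaB pS).
- move=> f g /set_mem Af /set_mem Ag /(congr1 (extension S')).
  by rewrite !(extensionK compactX compactY uaA uaB pS).
- move=> F BF; exists (extension S' F).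
    exact: (extension_in compactY uaB uaA pS').
  exact: (extensionK compactY compactX uaB uaA pS').
Qed.

Lemma supnorm_extension f : A f -> supnorm (extension S f) = supnorm f.
Proof.
move=> Af; have pS' := preserver_sym uaA pS.
apply/eqP; rewrite eq_le (supnorm_extension_le compactX compactY uaA uaB pS) //=.
have BL := extension_in compactX uaA uaB pS Af.
have := supnorm_extension_le compactY compactX uaB uaA pS' BL.
by rewrite (extensionK compactX compactY uaA uaB pS).
Qed.

(** The continuous function re (- i S i) takes only the values 1 and - 1 on the Choquet boundary. *)
Lemma conj_set_clopen (phi : set_type (choquet B) -> set_type (choquet A)) :
  (forall y, matched A S (val (phi y)) (val y)) ->
  clopen [set y : set_type (choquet B) | S (cst (ii R)) (val y) = ii R].
Proof.
move=> phiP.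
have i0 : ii R != 0 by rewrite -nrm_gt0 nrm_ii.
have Ai : ua_inv A (cst (ii R)) by exact: ua_inv_cst.
pose F := (- ii R) *: S (cst (ii R)).
have BF : B F by apply: ua_scale => //; apply: ua_inv_sub; exact: (pres_fun pS).
pose u (y : set_type (choquet B)) := re (F (val y)).
have cu : continuous u.
  move=> y; apply: (@continuous_comp _ _ _ (fun y : set_type (choquet B) => val y)
    (fun z => re (F z))); first exact: set_val_continuous.
  exact: (ua_continuous_re uaB BF).
have uE y : u y = if S (cst (ii R)) (val y) == ii R then 1 else -1.
  rewrite /u -[F _]/(- ii R * S (cst (ii R)) (val y)).
  case: eqP => [->|/eqP/negPf h]; first by rewrite !cE; ring.
  by rewrite (phiP y _ Ai) h /id_or_conj -[cst _ _]/(ii R) !cE; ring.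
split.
- have -> : [set y : set_type (choquet B) | S (cst (ii R)) (val y) = ii R] =
      u @^-1` [set r | 0 < r].
    apply/seteqP; split=> y /=; rewrite uE; first by move=> ->; rewrite eqxx.
    by case: eqP => // _; rewrite oppr_gt0 ltr10.
  by apply: open_comp; [move=> y _; exact: cu|exact: open_gt].
have -> : [set y : set_type (choquet B) | S (cst (ii R)) (val y) = ii R] =
    u @^-1` [set r | 0 <= r].
  apply/seteqP; split=> y /=; rewrite uE; first by move=> ->; rewrite eqxx.
  by case: eqP => // _; rewrite oppr_ge0 ler10.
by apply: closed_comp; [move=> y _; exact: cu|exact: closed_ge].
Qed.

End ExtensionTheorem.

Lemma matched_homeomorphism (R : realType) (X Y : topologicalType)
    (A : set (X -> cplx R)) (B : set (Y -> cplx R)) S S' :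
  compact [set: X] -> compact [set: Y] ->
  hausdorff_space X -> hausdorff_space Y ->
  uniform_algebra A -> uniform_algebra B -> preserver A B S S' ->
  exists2 phi : set_type (choquet B) -> set_type (choquet A),
    homeomorphism phi & forall y, matched A S (val (phi y)) (val y).
Proof.
move=> cX cY hX hY uaA uaB pS; have pS' := preserver_sym uaA pS.
have [phi phiP] := matched_map cX cY uaA uaB pS.
have [psi psiP] := matched_map cY cX uaB uaA pS'.
exists phi => //; split.
  exact: (matched_map_continuous cX hX uaA uaB pS).
exists psi; split.
- move=> y; apply: val_inj.
  exact: (matched_unique cX cY uaA uaB pS (phiP y) (psiP (phi y))).
- move=> x; apply: val_inj.
  exact: (matched_unique cY cX uaB uaA pS' (psiP x) (phiP (psi x))).
- exact: (matched_map_continuous cY hY uaB uaA pS').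
Qed.

Theorem theorem5p12 (R : realType) (X Y : topologicalType)
  (compactX : compact [set: X]) (hausdorffX : hausdorff_space X)
  (compactY : compact [set: Y]) (hausdorffY : hausdorff_space Y)
  (A : set (X -> cplx R)) (B : set (Y -> cplx R))
  (uaA : uniform_algebra A) (uaB : uniform_algebra B)
  (T : (X -> cplx R) -> (Y -> cplx R))
  (T_fun : set_fun (ua_inv A) (ua_inv B) T)
  (T_surj : set_surj (ua_inv A) (ua_inv B) T)
  (T_norm : forall f g, ua_inv A f -> ua_inv A g ->
     supnorm (T f * T g - 1) = supnorm (f * g - 1)) :
  (T 1) ^+ 2 = 1 /\
  exists TE : (X -> cplx R) -> (Y -> cplx R),
    [/\ (forall f, ua_inv A f -> TE f = T f),
        set_fun A B TE /\ set_surj A B TE,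
        exists (phi : set_type (choquet B) -> set_type (choquet A))
               (K : set (set_type (choquet B))),
          [/\ homeomorphism phi, clopen K &
              forall f, A f -> forall y : set_type (choquet B),
                TE f (val y) = T 1 (val y) *
                  (if y \in K then f (val (phi y))
                   else Num.conj (f (val (phi y))))],
        real_algebra_iso A B (fun f y => TE f y / T 1 y) &
        forall f g, A f -> A g ->
          supnorm (TE f * TE g - 1) = supnorm (f * g - 1)].
Proof.
have A1 := ua_inv_one uaA; have BT1 : ua_inv B (T 1) := T_fun _ A1.
have mulT f g : ua_inv A f -> ua_inv A g -> B (T f * T g - 1).
  move=> Af Ag; apply: ua_sub => //; last exact: ua_one.
  by apply: ua_inv_sub; apply: ua_inv_mul => //; exact: T_fun.
have ctsB F (BF : B F) := ua_continuous uaB BF.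
have ctsA f (Af : A f) := ua_continuous uaA Af.
have T11 : T 1 * T 1 = 1.
  apply/eqP; rewrite -subr_eq0; apply/eqP.
  apply: (supnorm0_eq0 compactY) => //; first by apply: ctsB; exact: mulT.
  by rewrite T_norm // mulr1 subrr (supnorm0 _ compactX).
have TK F : T 1 * (T 1 * F) = F by rewrite mulrA T11 mul1r.
split; first by rewrite expr2.
(* If T f = T g, then f (1 / g) - 1 has the same norm as g (1 / g) - 1, which is 0. *)
have T_inj f g : ua_inv A f -> ua_inv A g -> T f = T g -> f = g.
  move=> Af Ag Tfg; have Ag' := ua_inv_inv Ag.
  set g' := (fun x => (g x)^-1) in Ag'.
  have gg' : g * g' = 1.
    by apply/funext => x; rewrite -[LHS]/(g x / g x) divff //; exact: ua_inv_neq0 Ag.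
  suff fg' : f * g' = 1.
    apply/funext => x; have gx := ua_inv_neq0 x Ag.
    by rewrite -[LHS](divfK gx) -[f x / g x]/((f * g') x) fg' -[LHS]/(1 * g x) mul1r.
  apply/eqP; rewrite -subr_eq0; apply/eqP; apply: (supnorm0_eq0 compactX) => //.
    apply: ctsA; apply: ua_sub => //; last exact: ua_one.
    by apply: ua_inv_sub; exact: ua_inv_mul.
  by rewrite -T_norm // Tfg T_norm // gg' subrr (supnorm0 _ compactX).
(* As (T 1)^2 = 1, multiplying by T 1 is dividing by it, and the two factors cancel in S f * S g. *)
pose S f := T 1 * T f.
have BS f : ua_inv A f -> ua_inv B (S f).
  by move=> Af; apply: ua_inv_mul => //; exact: T_fun.
have [S' S'P] : exists S' : (Y -> cplx R) -> (X -> cplx R),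
    forall F, ua_inv B F -> ua_inv A (S' F) /\ S (S' F) = F.
  suff /choice[S' S'P] : forall F, exists f, ua_inv B F -> ua_inv A f /\ S f = F.
    by exists S'.
  move=> F; have [BF|nBF] := pselect (ua_inv B F); last by exists 0.
  have [f Af Tf] := T_surj _ (ua_inv_mul uaB BT1 BF).
  by exists f => _; split=> //; rewrite /S Tf TK.
have pS : preserver A B S S'.
  split=> //.
  - by move=> F /S'P[].
  - move=> f Af; have [h1 h2] := S'P _ (BS _ Af); apply: T_inj => //.
    by rewrite -[LHS]TK -[RHS]TK; congr (_ * _).
  - by move=> F /S'P[].
  - by move=> f g Af Ag; rewrite /S mulrACA T11 mul1r T_norm.
have [phi hphi phiP] := matched_homeomorphism compactX compactY hausdorffX hausdorffY uaA uaB pS.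
have LA f (Af : A f) := extension_in compactX uaA uaB pS Af.
have [_ _ Lsurj] := extension_bij compactX compactY uaA uaB pS.
exists (fun f => T 1 * extension S f); split.
- by move=> f Af; rewrite (extensionE compactX compactY uaA uaB pS) // TK.
- split=> [f Af|F BF]; first by apply: ua_mul => //; [exact: ua_inv_sub|exact: LA].
  have [f Af Lf] := Lsurj (T 1 * F) (ua_mul uaB (ua_inv_sub BT1) BF).
  by exists f => //; rewrite Lf TK.
- exists phi, [set y : set_type (choquet B) | S (cst (ii R)) (val y) = ii R]; split=> //.
    exact: (conj_set_clopen uaA uaB pS phiP).
  move=> f Af y; rewrite -[LHS]/(T 1 (val y) * extension S f (val y)).
  rewrite (extension_matched compactX uaA (phiP y) Af); congr (_ * _).
  by rewrite /id_or_conj; case: eqP => h; [rewrite mem_set|rewrite memNset].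
- have -> : (fun f y => (T 1 * extension S f) y / T 1 y) = extension S.
    apply/funext => f; apply/funext => y.
    rewrite -[LHS]/(T 1 y * extension S f y / T 1 y) mulrC mulrA mulVf ?mul1r //.
    exact: ua_inv_neq0 BT1.
  split.
  + exact: (extension_bij compactX compactY uaA uaB pS).
  + by move=> r f g; exact: (extension_linear compactX compactY uaA uaB pS).
  + by move=> f g; exact: (extension_mul compactX compactY uaA uaB pS).
move=> f g Af Ag; rewrite mulrACA T11 mul1r.
rewrite -(extension_mul compactX compactY uaA uaB pS Af Ag).
have Afg := ua_mul uaA Af Ag.
(* The extension is real-linear and fixes 1, so the difference is the image of f g - 1, whose norm
   is preserved. *)
have -> : extension S (f * g) - 1 = extension S (f * g - 1).
  have := extension_linear compactX compactY uaA uaB pS (-1) (ua_one uaA) Afg.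
  rewrite (extension_one compactX compactY uaA uaB pS).
  by rewrite of_realN of_real1 !scaleN1r [_ - 1]addrC [f * g - 1]addrC => ->.
rewrite (supnorm_extension compactX compactY uaA uaB pS) //.
by apply: ua_sub => //; exact: ua_one.
Qed.
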